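(* Let $R\subseteq\mathbb N$ be a congruence-periodic sparse predicate. Then the structure $(\mathbb Z,<,+,R)$ is distal.
   Context: Let $R\subseteq\mathbb N$ be infinite, enumerated increasingly as $(r_n)_{n\in\mathbb N}$. Let $\sigma:R\to R$ be the successor map $\sigma(r_n)=r_{n+1}$, $\sigma^k$ its $k$-fold iterate ($\sigma^0=\mathrm{id}$). An operator on $R$ is a function $R\to\mathbb Z$ of the form $z\mapsto a_m\sigma^m(z)+\dots+a_0\sigma^0(z)$ with $a_i\in\mathbb Z$. For an operator $A$: $A=_R0$ if $Az=0$ for all $z\in R$; $A>_R0$ (resp. $A<_R0$) if $Az>0$ (resp. $Az<0$) for all but finitely many $z\in R$. $R$ is sparse if every operator $A$ satisfies (S1) $A=_R0$ or $A>_R0$ or $A<_R0$; and (S2) if $A>_R0$ then there is $\Delta\in\mathbb N$ with $A(\sigma^\Delta z)>z$ for all $z\in R$. $R$ is congruence-periodic if for every $m\in\mathbb N^+$ the sequence $(r_n \bmod m)_n$ is eventually periodic. A structure $\mathcal M$ in a language $\mathcal L$ is distal if every partitioned $\mathcal L$-formula $\phi(x;y)$ has a strong honest definition, i.e. a formula $\psi(x;y^{(1)},\dots,y^{(k)})$ such that for every $a\in M^{x}$ and every finite $B\subseteq M^{y}$ with $|B|\ge2$ there is $c\in B^k$ with $\mathcal M\models\psi(a;c)$ and, for all $a'\in M^x$ with $\mathcal M\models\psi(a';c)$ and all $b\in B$, $\mathcal M\models\phi(a;b)\leftrightarrow\phi(a';b)$. *)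

(* Defs.v *)
From mathcomp Require Import all_boot all_order all_algebra.
Set Implicit Arguments. Unset Strict Implicit. Unset Printing Implicit Defensive.
Import Order.TTheory GRing.Theory Num.Theory.
Local Open Scope ring_scope.

Definition enumerates (R : nat -> Prop) (r : nat -> nat) : Prop :=
  (forall n, (r n < r n.+1)%N) /\ (forall z, R z <-> exists n, r n = z).

(* An operator A = a_m sigma^m + ... + a_0 sigma^0 is given by its list of
   coefficients a = [:: a_0; ...; a_m]; its value at z = r_n is
   sum_i a_i * r_{n+i}. *)
Definition op_at (r : nat -> nat) (a : seq int) (n : nat) : int :=
  \sum_(i < size a) a`_i * ((r (n + i)%N)%:Z).

Definition op_eq0 r a : Prop := forall n, op_at r a n = 0.
(* "for all but finitely many z in R" = for all but finitely many indices n *)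
Definition op_gt0 r a : Prop := exists N, forall n, (N <= n)%N -> 0 < op_at r a n.
Definition op_lt0 r a : Prop := exists N, forall n, (N <= n)%N -> op_at r a n < 0.

Definition sparse_enum (r : nat -> nat) : Prop :=
  forall a : seq int,
    (op_eq0 r a \/ op_gt0 r a \/ op_lt0 r a) /\
    (op_gt0 r a -> exists D : nat, forall n, (r n)%:Z < op_at r a (n + D)%N).

Definition cong_periodic_enum (r : nat -> nat) : Prop :=
  forall m : nat, (0 < m)%N ->
    exists N p : nat, (0 < p)%N /\
      forall n, (N <= n)%N -> (r (n + p) %% m = r n %% m)%N.

Inductive term : Type :=
  | TVar : nat -> term
  | TAdd : term -> term -> term.

Inductive formula : Type :=
  | FLt : term -> term -> formula
  | FEq : term -> term -> formula
  | FR  : term -> formula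
  | FNot : formula -> formula
  | FAnd : formula -> formula -> formula
  | FEx : nat -> formula -> formula.

Fixpoint teval (e : nat -> int) (t : term) : int :=
  match t with
  | TVar i => e i
  | TAdd t1 t2 => teval e t1 + teval e t2
  end.

Fixpoint holds (R : nat -> Prop) (e : nat -> int) (f : formula) : Prop :=
  match f with
  | FLt t1 t2 => teval e t1 < teval e t2
  | FEq t1 t2 => teval e t1 = teval e t2
  | FR t => 0 <= teval e t /\ R (absz (teval e t))
  | FNot g => ~ holds R e g
  | FAnd g h => holds R e g /\ holds R e h
  | FEx i g => exists v : int, holds R (fun j => if j == i then v else e j) g
  end.

Definition sat (R : nat -> Prop) (f : formula) (s : seq int) : Prop :=
  holds R (fun j => nth 0 s j) f.

(* A partitioned formula phi(x;y) with |x| = n, |y| = m is a formula whose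
   variables 0..n-1 are x and n..n+m-1 are y.  psi(x; y^(1),...,y^(k)) has
   variables 0..n-1 for x and then k consecutive blocks of m variables. *)
Definition strong_honest_def (R : nat -> Prop) (n m : nat) (phi : formula)
    (k : nat) (psi : formula) : Prop :=
  forall a : seq int, size a = n ->
  forall B : seq (seq int), uniq B -> (2 <= size B)%N ->
    (forall b, b \in B -> size b = m) ->
    exists c : seq (seq int),
      [/\ size c = k, (forall ci, ci \in c -> ci \in B),
          sat R psi (a ++ flatten c) &
          forall a' : seq int, size a' = n -> sat R psi (a' ++ flatten c) ->
            forall b, b \in B -> (sat R phi (a ++ b) <-> sat R phi (a' ++ b))].

Definition distal_ZltaddR (R : nat -> Prop) : Prop :=
  forall (n m : nat) (phi : formula),
    exists (k : nat) (psi : formula), strong_honest_def R n m phi k psi.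

(* Main.v *)
Require Import Defs.
From Stdlib Require Import FunctionalExtensionality.
From Stdlib Require List.
From mathcomp Require Import all_boot all_order all_algebra.
From mathcomp Require Import zify ring.

Set Implicit Arguments.
Unset Strict Implicit.
Unset Printing Implicit Defensive.
Import Order.TTheory GRing.Theory Num.Theory.
Local Open Scope ring_scope.

(** Let lam(t) be the largest element of R that is at most t.  Over the terms
    generated by +, floor division and the shifts of lam, every formula becomes
    quantifier-free and has a strong honest definition.  Both facts rest on two
    observations.

    - Tameness.  A quantifier-free formula phi(x; y) depends only on the position
      of x among finitely many terms in y and on finitely many colours (residues)
      of x, in two cases: x ranges over Z and lam is not applied to terms in x, or
      x ranges over R.  In the second case, sparsity makes every term in x = r_n
      equal to (A r_n + s(y)) / D, piecewise in x, for an operator A.  Tame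
      formulas have quantifier elimination, as a witness can be moved close to
      one of the terms (for R this uses congruence-periodicity), and they have
      strong honest definitions, by taking the nearest terms on both sides.

    - Induction on the number of lam above x.  Write phi(x; y) as
      phi'(x, lam(t(x, y)); y) with t free of lam above x.  To eliminate x, first
      eliminate it from phi'(x, z; y) and then eliminate z in R.  For strong honest
      definitions over B, choose c in B with |t(x, c)| minimal and put
      z = lam |t(x, c)|.  There is no cancellation in
      t(x, b) = t(x, c) + (t(x, b) - t(x, c)), so lam(t(x, b)) is within boundedly
      many steps of z or of lam |t(x, b) - t(x, c)|, and this difference involves
      x only through a residue.  So phi(x; b) has smaller rank over the pair (z, c),
      where z ranges over R.

    Several variables are handled one at a time, replacing the formula
    phi(x, v; y) by "psi(x; v, c) implies phi(x, v; y) for all x". *)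

(** * Indices of integers in the enumeration of [R] *)

Section Sparse.

Variable r : nat -> nat.
Hypothesis r_incr : forall n, (r n < r n.+1)%N.

Fixpoint idxn (k : nat) : nat :=
  if k is k'.+1 then
    if (r (idxn k').+1 <= k)%N then (idxn k').+1 else idxn k'
  else 0%N.

(* The largest n with r n <= t, and 0 when t < r 0. *)
Definition idx (t : int) : nat := if t is Posz k then idxn k else 0%N.

Lemma ltn_r m n : (m < n)%N -> (r m < r n)%N.
Proof.
elim: n => // n IH; rewrite ltnS leq_eqVlt => /orP[/eqP-> //|/IH lt_mn].
exact: ltn_trans lt_mn (r_incr n).
Qed.

Lemma leq_r m n : (r m <= r n)%N = (m <= n)%N.
Proof.
case: (leqP m n) => [|/ltn_r]; last by rewrite ltnNge => /negbTE.
by rewrite leq_eqVlt => /orP[/eqP->|/ltn_r/ltnW] //; rewrite leqnn.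
Qed.

Lemma r_geS n : (n < r n.+1)%N.
Proof. by elim: n => [|n IH]; [have := r_incr 0%N | have := r_incr n.+1]; lia. Qed.

Lemma idxnP k :
  (k < r (idxn k).+1)%N /\ ((r (idxn k) <= k)%N \/ idxn k = 0%N).
Proof.
elim: k => [|k [lt_k le_k]] /=; first by split; [exact: r_geS|right].
case: ifP => h; first by split; [have := r_incr (idxn k).+1; lia|left].
by split; [lia|case: le_k => ?; [left; lia|right]].
Qed.

Lemma idx_lt t : t < (r (idx t).+1)%:Z.
Proof. by case: t => k //=; case: (idxnP k); lia. Qed.

Lemma idx_pos t : (0 < idx t)%N -> (r (idx t))%:Z <= t.
Proof. by case: t => k //=; case: (idxnP k) => _ [|-> //]; lia. Qed.

Lemma idx_leP t n : (idx t <= n)%N = (t < (r n.+1)%:Z).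
Proof.
apply/idP/idP => [le_n|lt_t].
  have := idx_lt t; have : (r (idx t).+1 <= r n.+1)%N by rewrite leq_r.
  lia.
rewrite leqNgt; apply/negP => lt_n.
have := idx_pos (leq_ltn_trans (leq0n n) lt_n).
by move: lt_n; rewrite -leq_r; lia.
Qed.

Lemma idx_ge t n : (r n)%:Z <= t -> (n <= idx t)%N.
Proof. by case: n => // n le_t; rewrite ltnNge idx_leP; lia. Qed.

Lemma idx_r n : idx (r n)%:Z = n.
Proof.
apply/eqP; rewrite eqn_leq idx_ge // andbT idx_leP.
by have := r_incr n; lia.
Qed.

Lemma idx_neg t : t < 0 -> idx t = 0%N.
Proof. by case: t => //= k; lia. Qed.

Arguments idx : simpl never.

Lemma eq_idx t k : (t < (r k.+1)%:Z) -> ((r k)%:Z <= t \/ k = 0%N) -> idx t = k.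
Proof.
rewrite -idx_leP => h [/idx_ge|] h'; first by apply/eqP; rewrite eqn_leq h.
by apply/eqP; rewrite h' in h *; rewrite -leqn0.
Qed.

(** * Growth of a sparse sequence *)

Hypothesis r_sparse : sparse_enum r.

(** Apply (S2) to sigma - id, which is positive because [r] increases: some [d] gives r_n <
    r_{n+d+1} - r_{n+d}, and r_{n+d} is at least r_n. *)
Lemma r_double : exists d, forall n, (2 * r n <= r (n + d))%N.
Proof.
have [_ H] := r_sparse [:: -1; 1].
have opE n : op_at r [:: -1; 1] n = (r n.+1)%:Z - (r n)%:Z.
  by rewrite /op_at !big_ord_recl big_ord0 /= addn0 addn1; lia.
have [|d Hd] := H; first by exists 0%N => n _; rewrite opE; have := r_incr n; lia.
exists d.+1 => n; have := Hd n; rewrite opE addnS.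
by have := leq_r n (n + d); rewrite leq_addr; lia.
Qed.

Lemma r_growth (C : nat) : exists d, forall n, (C * r n <= r (n + d))%N.
Proof.
have [d Hd] := r_double.
elim: C => [|C [dC IH]]; first by exists 0%N.
exists (dC + d)%N => n; rewrite addnA mulSn.
have := Hd (n + dC)%N; have := IH n; have := leq_r n (n + dC).
by rewrite leq_addr; lia.
Qed.

(** Multiplication by a constant moves the index by boundedly many steps. Later estimates compare
    sizes up to a factor and use this to confine an index to a bounded window. *)
Lemma idx_mul (C : nat) :
  exists d, forall a b : int, a <= C%:Z * b -> (idx a <= idx b + d)%N.
Proof.
have [d Hd] := r_growth C; exists d => a b le_ab.
rewrite idx_leP; have lt_b := idx_lt b; have := Hd (idx b).+1.
have := r_geS (idx b + d); rewrite addSn.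
have : C%:Z * b <= C%:Z * ((r (idx b).+1)%:Z - 1) by apply: ler_wpM2l; lia.
rewrite mulrBr mulr1 -PoszM.
by case: (C) le_ab => [|C'] le_ab; lia.
Qed.

(** * Operators *)

(* Operators evaluated at the index n of r_n, possibly with negative shifts,
   which is why the representation is only required from some index J on. *)
Definition opfun (g : nat -> int) : Prop :=
  exists J (p : {poly int}), forall n, (J <= n)%N -> g n = op_at r p (n - J).

(** Coefficient lists are read as integer polynomials, so that operators are added and scaled as
    polynomials and ['X] acts as sigma. Padding the sum to a common length [N] reduces this to
    coefficients. *)
Lemma op_atE (p : {poly int}) n N : (size p <= N)%N ->
  op_at r p n = \sum_(i < N) p`_i * (r (n + i)%N)%:Z.
Proof.
move=> le_pN; rewrite /op_at.
rewrite (big_ord_widen N (fun i => p`_i * (r (n + i)%N)%:Z) le_pN) big_mkcond.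
apply: eq_bigr => i _; case: ltnP => // /(nth_default 0) ->.
by rewrite mul0r.
Qed.

Lemma op_atD (p q : {poly int}) n :
  op_at r (p + q) n = op_at r p n + op_at r q n.
Proof.
pose N := maxn (size p) (size q).
rewrite (@op_atE (p + q) n N) ?(@op_atE p n N) ?(@op_atE q n N) ?leq_maxl
  ?leq_maxr ?size_polyD // -big_split /=.
by apply: eq_bigr => i _; rewrite coefD mulrDl.
Qed.

Lemma op_atZ c (p : {poly int}) n : op_at r (c *: p) n = c * op_at r p n.
Proof.
rewrite (@op_atE (c *: p) n (size p)) ?size_scale_leq //
  (@op_atE p n (size p)) // mulr_sumr.
by apply: eq_bigr => i _; rewrite coefZ mulrA.
Qed.

Lemma op_atXn k (p : {poly int}) n : op_at r ('X^k * p) n = op_at r p (n + k).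
Proof.
rewrite (@op_atE ('X^k * p) n (k + size p)); last first.
  by rewrite (leq_trans (size_polyMleq _ _)) // size_polyXn.
rewrite big_split_ord /= big1 ?add0r => [|i _]; last by rewrite coefXnM ltn_ord mul0r.
by apply: eq_bigr => i _; rewrite coefXnM ltnNge leq_addr addKn addnA.
Qed.

Lemma opfun_r u d : opfun (fun n => (r (n - d + u)%N)%:Z).
Proof.
exists d, 'X^u => n _; rewrite -(mulr1 'X^u) op_atXn.
by rewrite /op_at size_poly1 big_ord1 coefC eqxx mul1r addn0.
Qed.

Lemma opfunD f g : opfun f -> opfun g -> opfun (fun n => f n + g n).
Proof.
(* Both representations are moved to the common starting index I + J; a power of ['X] undoes the
   extra backward shift. *)
move=> [I [p Hp]] [J [q Hq]]; exists (I + J)%N, ('X^J * p + 'X^I * q) => n le_n.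
by rewrite op_atD !op_atXn Hp ?Hq; try lia; congr (op_at r _ _ + op_at r _ _); lia.
Qed.

Lemma opfunZ c g : opfun g -> opfun (fun n => c * g n).
Proof. by move=> [J [p Hp]]; exists J, (c *: p) => n /Hp ->; rewrite op_atZ. Qed.

Lemma opfun0 : opfun (fun=> 0).
Proof. by exists 0%N, 0 => n _; rewrite /op_at size_poly0 big_ord0. Qed.

(** A quantitative form of (S1): if [g] is not eventually zero, then (S2) for the operator or its
    negative bounds |g| from below by a fixed backward shift of r_n. *)
Lemma opfun_trichotomy g : opfun g ->
  [\/ exists N, forall n, (N <= n)%N -> g n = 0,
      exists d, forall n, (d <= n)%N -> (r (n - d))%:Z < g n |
      exists d, forall n, (d <= n)%N -> (r (n - d))%:Z < - g n].
Proof.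
have pos (h : nat -> int) J (p : {poly int}) : op_gt0 r p ->
    (forall n, (J <= n)%N -> h n = op_at r p (n - J)) ->
    exists d, forall n, (d <= n)%N -> (r (n - d))%:Z < h n.
  move=> p_gt0 Hp; have [_ /(_ p_gt0) [d Hd]] := r_sparse p.
  exists (J + d)%N => n le_n; rewrite Hp; last by lia.
  by have := Hd (n - (J + d))%N; rewrite subnDA subnK //; lia.
move=> [J [p Hp]]; have [[p0|[p_gt0|p_lt0]] _] := r_sparse p.
- by constructor 1; exists J => n /Hp ->; rewrite p0.
- by constructor 2; exact: pos p_gt0 Hp.
- have N1p n : op_at r (-1 *: p) n = - op_at r p n by rewrite op_atZ mulN1r.
  constructor 3; apply: (pos (fun n => - g n) J (-1 *: p)).
    by have [N HN] := p_lt0; exists N => n /HN; rewrite N1p oppr_gt0.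
  by move=> n /Hp ->; rewrite N1p.
Qed.

(** The sum [C] of the absolute values of the coefficients is absorbed into a shift by the growth of
    [r]. *)
Lemma opfun_bound g : opfun g ->
  exists d N, forall n, (N <= n)%N -> `|g n| <= (r (n + d))%:Z.
Proof.
move=> [J [p Hp]]; pose C := (\sum_(i < size p) absz (p`_i)%R)%N.
have [d Hd] := r_growth C; exists (size p + d)%N, J => n le_n.
rewrite Hp // (le_trans (ler_norm_sum _ _ _)) //.
apply: (@le_trans _ _ (C%:Z * (r (n + size p))%:Z)); last first.
  by rewrite -PoszM lez_nat addnA Hd.
rewrite -[C%:Z]natz natr_sum mulr_suml; apply: ler_sum => i _.
rewrite normrM natz abszE ler_wpM2l // ger0_norm // lez_nat leq_r.
by apply: leq_add; [exact: leq_subr | exact: ltnW (ltn_ord i)].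
Qed.

Lemma opfun_cong g (M : nat) : opfun g ->
  exists J K N, forall n n', (N <= n)%N -> (N <= n')%N ->
    (forall i, (i < K)%N ->
       (M%:Z %| (r (n - J + i))%:Z - (r (n' - J + i))%:Z)%Z) ->
    (M%:Z %| g n - g n')%Z.
Proof.
move=> [J [p Hp]]; exists J, (size p), J => n n' le_n le_n' H.
rewrite !Hp // /op_at -sumrB; apply: rpred_sum => i _.
by rewrite -mulrBr dvdz_mull // H.
Qed.

(** * Terms and quantifier-free formulas *)

(* [Div d t] is floor division by d+1, and [TR u d t] is sigma^(u-d) of the
   largest element of R that is at most t; both this element and the backward
   shift default to r 0 when they do not exist. *)
Inductive tm (V : Type) : Type :=
  | Var of V
  | Cst of int
  | Add of tm V & tm V
  | Mul of int & tm V
  | Div of nat & tm V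
  | TR of nat & nat & tm V.

Inductive qf (V : Type) : Type :=
  | Pos of tm V
  | Not of qf V
  | And of qf V & qf V.

Arguments Cst {V} c.

Fixpoint tev V (e : V -> int) (t : tm V) : int :=
  match t with
  | Var v => e v
  | Cst c => c
  | Add t1 t2 => tev e t1 + tev e t2
  | Mul c t1 => c * tev e t1
  | Div d t1 => (tev e t1 %/ d.+1%:Z)%Z
  | TR u d t1 => (r (idx (tev e t1) - d + u))%:Z
  end.

Fixpoint qev V (e : V -> int) (f : qf V) : bool :=
  match f with
  | Pos t => 0 < tev e t
  | Not g => ~~ qev e g
  | And g h => qev e g && qev e h
  end.

Fixpoint tsub V W (s : V -> tm W) (t : tm V) : tm W :=
  match t with
  | Var v => s v
  | Cst c => Cst c
  | Add t1 t2 => Add (tsub s t1) (tsub s t2)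
  | Mul c t1 => Mul c (tsub s t1)
  | Div d t1 => Div d (tsub s t1)
  | TR u d t1 => TR u d (tsub s t1)
  end.

Fixpoint qsub V W (s : V -> tm W) (f : qf V) : qf W :=
  match f with
  | Pos t => Pos (tsub s t)
  | Not g => Not (qsub s g)
  | And g h => And (qsub s g) (qsub s h)
  end.

Definition ext V (a : int) (e : V -> int) : option V -> int :=
  fun o => if o is Some v then e v else a.

Definition tren V W (h : V -> W) : tm V -> tm W := tsub (fun v => Var (h v)).
Definition qren V W (h : V -> W) : qf V -> qf W := qsub (fun v => Var (h v)).

Definition inst V (c : tm V) (o : option V) : tm V :=
  if o is Some v then Var v else c.

Lemma eq_tev V (e e' : V -> int) t : e =1 e' -> tev e t = tev e' t.
Proof.
move=> ee'; elim: t => //= [t1 -> t2 -> //|c t -> //|d t -> //|u d t -> //].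
Qed.

Lemma tev_sub V W (s : V -> tm W) e t :
  tev e (tsub s t) = tev (fun v => tev e (s v)) t.
Proof.
by elim: t => //= [t1 -> t2 -> //|c t -> //|d t -> //|u d t -> //].
Qed.

Lemma eq_qev V (e e' : V -> int) f : e =1 e' -> qev e f = qev e' f.
Proof.
by move=> ee'; elim: f => //= [t|g ->|g -> h ->//] //; rewrite (eq_tev _ ee').
Qed.

Lemma qev_sub V W (s : V -> tm W) e f :
  qev e (qsub s f) = qev (fun v => tev e (s v)) f.
Proof. by elim: f => //= [t|g ->|g -> h ->//] //; rewrite tev_sub. Qed.

Lemma tev_inst V (c : tm V) e t : tev e (tsub (inst c) t) = tev (ext (tev e c) e) t.
Proof. by rewrite tev_sub; apply: eq_tev; case. Qed.

Lemma qev_inst V (c : tm V) e f : qev e (qsub (inst c) f) = qev (ext (tev e c) e) f.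
Proof. by rewrite qev_sub; apply: eq_qev; case. Qed.

(** Quantifier-free definability in the extended language, as a property of predicates on
    valuations, so that formulas need not be written out. *)
Definition def V (P : (V -> int) -> Prop) : Prop :=
  exists f : qf V, forall e, P e <-> qev e f.

Lemma defP V (P : (V -> int) -> Prop) e : def P -> P e \/ ~ P e.
Proof. by case=> f ->; case: (qev e f); [left | right]. Qed.

Lemma def_iff V (P Q : (V -> int) -> Prop) :
  (forall e, P e <-> Q e) -> def P -> def Q.
Proof. by move=> PQ [f Hf]; exists f => e; rewrite -PQ. Qed.

Lemma def_qf V (f : qf V) : def (fun e => qev e f).
Proof. by exists f. Qed.

Lemma def_sub V W (P : (V -> int) -> Prop) (s : V -> tm W) :
  def P -> def (fun e => P (fun v => tev e (s v))).
Proof. by move=> [f Hf]; exists (qsub s f) => e; rewrite qev_sub Hf. Qed.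

Lemma def_ren V W (P : (V -> int) -> Prop) (h : V -> W) :
  def P -> def (fun e => P (fun v => e (h v))).
Proof. exact: (@def_sub V W P (fun v => Var (h v))). Qed.

Lemma def_not V (P : (V -> int) -> Prop) : def P -> def (fun e => ~ P e).
Proof. by case=> f Hf; exists (Not f) => e /=; rewrite Hf; split=> /negP. Qed.

Lemma def_and V (P Q : (V -> int) -> Prop) :
  def P -> def Q -> def (fun e => P e /\ Q e).
Proof.
case=> f Hf [g Hg]; exists (And f g) => e /=; rewrite Hf Hg.
by split=> /andP.
Qed.

Lemma def_or V (P Q : (V -> int) -> Prop) :
  def P -> def Q -> def (fun e => P e \/ Q e).
Proof.
move=> dP dQ; apply: def_iff (def_not (def_and (def_not dP) (def_not dQ))) => e.
by case: (defP e dP) (defP e dQ) => ? [] ?; tauto.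
Qed.

Lemma def_imp V (P Q : (V -> int) -> Prop) :
  def P -> def Q -> def (fun e => P e -> Q e).
Proof.
move=> dP dQ; apply: def_iff (def_not (def_and dP (def_not dQ))) => e.
by case: (defP e dP) (defP e dQ) => ? [] ?; tauto.
Qed.

Lemma def_true V : def (fun _ : V -> int => True).
Proof. by exists (Pos (Cst 1)). Qed.

Lemma def_lt V (s t : tm V) : def (fun e => tev e s < tev e t).
Proof.
exists (Pos (Add t (Mul (-1) s))) => e /=.
by rewrite mulN1r subr_gt0.
Qed.

Lemma def_le V (s t : tm V) : def (fun e => tev e s <= tev e t).
Proof. by apply: def_iff (def_not (def_lt t s)) => e; rewrite leNgt; split=> /negP. Qed.

Lemma def_eq V (s t : tm V) : def (fun e => tev e s = tev e t).
Proof.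
apply: def_iff (def_and (def_le s t) (def_le t s)) => e; split=> [[]|->//].
by lia.
Qed.

Lemma def_all_in V (T : Type) (P : T -> (V -> int) -> Prop) (s : seq T) :
  (forall i, def (P i)) -> def (fun e => forall i, List.In i s -> P i e).
Proof.
move=> dP; elim: s => [|i s IH]; first by apply: def_iff (def_true V).
apply: def_iff (def_and (dP i) IH) => e /=; split.
  by move=> [Pi Ps] j [<-|/Ps].
by move=> H; split=> [|j Hj]; apply: H; [left|right].
Qed.

Lemma In_mem (T : eqType) (s : seq T) x : x \in s <-> List.In x s.
Proof.
elim: s => [|y s IH] //=; rewrite in_cons; split.
  by move=> /orP[/eqP->|/IH]; [left|right].
by move=> [->|/IH ->]; rewrite ?eqxx ?orbT.
Qed.

Lemma def_forall V (T : finType) (P : T -> (V -> int) -> Prop) :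
  (forall i, def (P i)) -> def (fun e => forall i, P i e).
Proof.
move=> dP; apply: def_iff (def_all_in (enum T) dP) => e.
by split=> H i; [apply: H; apply/In_mem; rewrite mem_enum|move=> _; exact: H].
Qed.

Lemma def_exists_in V (T : Type) (P : T -> (V -> int) -> Prop) (s : seq T) :
  (forall i, def (P i)) -> def (fun e => exists i, List.In i s /\ P i e).
Proof.
move=> dP; elim: s => [|i s IH].
  by apply: def_iff (def_not (def_true V)) => e; split=> // [[? []]].
apply: def_iff (def_or (dP i) IH) => e /=; split.
  by move=> [Pi|[j [sj Pj]]]; [exists i; split=> //; left|exists j; split=> //; right].
by move=> [j [[<-|sj] Pj]]; [left|right; exists j].
Qed.

Lemma def_exists_lt V (m : nat) (P : nat -> (V -> int) -> Prop) :
  (forall k, def (P k)) -> def (fun e => exists2 k, (k < m)%N & P k e).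
Proof.
move=> /def_exists_in dP; apply: def_iff (dP (iota 0 m)) => e.
split=> [[k [/In_mem]]|[k lt_k Pk]]; first by rewrite mem_iota; exists k.
by exists k; split=> //; apply/In_mem; rewrite mem_iota.
Qed.

(** * Tame relations *)

(* Relations T x x' e that hold as soon as x and x' in D lie in the same cut of
   finitely many terms in e and have the same finitely many colours. *)
Inductive tame (D : int -> Prop) (C : (int -> bool) -> Prop) V :
    (int -> int -> (V -> int) -> Prop) -> Prop :=
  | tame_cut (f : tm V) :
      tame D C (fun x x' e => (x < tev e f) = (x' < tev e f))
  | tame_col (chi : int -> bool) : C chi ->
      tame D C (fun x x' _ => chi x = chi x')
  | tame_and T1 T2 : tame D C T1 -> tame D C T2 ->
      tame D C (fun x x' e => T1 x x' e /\ T2 x x' e)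
  | tame_mono T1 T2 : tame D C T1 ->
      (forall x x' e, D x -> D x' -> T1 x x' e -> T2 x x' e) -> tame D C T2.

Section Tame.
Variables (D : int -> Prop) (C : (int -> bool) -> Prop) (V : Type).
Implicit Types T : int -> int -> (V -> int) -> Prop.

Lemma tame_const T : (forall x x' e, D x -> D x' -> T x x' e) -> tame D C T.
Proof.
move=> H; refine (tame_mono (tame_cut _ _ (Cst 0)) _) => x x' e Dx Dx' _.
exact: H.
Qed.

Lemma tame_mono2 T1 T2 T3 : tame D C T1 -> tame D C T2 ->
  (forall x x' e, D x -> D x' -> T1 x x' e -> T2 x x' e -> T3 x x' e) ->
  tame D C T3.
Proof.
move=> t1 t2 H; refine (tame_mono (tame_and t1 t2) _) => x x' e Dx Dx' [].
exact: H.
Qed.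

Lemma tame_all (m : nat) (T : nat -> int -> int -> (V -> int) -> Prop) :
  (forall k, (k < m)%N -> tame D C (T k)) ->
  tame D C (fun x x' e => forall k, (k < m)%N -> T k x x' e).
Proof.
elim: m => [|m IH] H; first exact: tame_const.
refine (tame_mono2 (IH _) (H m (leqnn _)) _) => [k lt_km|x x' e _ _ Hm Tm k].
  by apply: H; exact: ltnW.
by rewrite ltnS leq_eqVlt => /orP[/eqP->|/Hm].
Qed.

Lemma tame_cases (m : nat) (P : nat -> int -> int -> (V -> int) -> Prop) T :
  tame D C (fun x x' e => exists2 k, (k < m)%N & P k x x' e) ->
  (forall k, (k < m)%N -> tame D C (fun x x' e => P k x x' e -> T x x' e)) ->
  tame D C T.
Proof.
move=> H1 /tame_all H2; refine (tame_mono2 H1 H2 _) => x x' e _ _ [k lt_k Pk] H.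
exact: H Pk.
Qed.

(** Normal form with finitely many cuts and a single modulus. The relation [eqv] is left abstract:
    it is congruence of values over Z and congruence of large indices over R. *)
Lemma tame_bounded (eqv : nat -> int -> int -> Prop) T :
  (forall chi, C chi -> exists2 q, (0 < q)%N &
     forall x x', D x -> D x' -> eqv q x x' -> chi x = chi x') ->
  (forall p q x x', (0 < p)%N -> (0 < q)%N -> eqv (p * q)%N x x' ->
     eqv p x x' /\ eqv q x x') ->
  tame D C T ->
  exists (F : seq (tm V)) q, (0 < q)%N /\ forall x x' e, D x -> D x' ->
    eqv q x x' ->
    (forall f, List.In f F -> (x < tev e f) = (x' < tev e f)) -> T x x' e.
Proof.
move=> Hchi Heqv; elim=> {T} [f|chi /Hchi[q q0 Hq]|T1 T2 _ H1 _ H2|T1 T2 _ H T12].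
- by exists [:: f], 1%N; split=> // x x' e _ _ _ H; apply: H; left.
- by exists [::], q; split=> // x x' e Dx Dx' /Hq ->.
- have [F1 [q1 [q10 {}H1]]] := H1; have [F2 [q2 [q20 {}H2]]] := H2.
  exists (F1 ++ F2), (q1 * q2)%N; split; first by rewrite muln_gt0 q10.
  move=> x x' e Dx Dx' /Heqv[] // E1 E2 H; split.
    by apply: H1 => // f Ff; apply/H/List.in_or_app; left.
  by apply: H2 => // f Ff; apply/H/List.in_or_app; right.
have [F [q [q0 {}H]]] := H; exists F, q; split=> // x x' e Dx Dx' E HF.
exact: T12 (H _ _ _ _ _ E HF).
Qed.

End Tame.

(** * Colours on Z and on R, and elimination of a tame quantifier *)

Definition Zcol (chi : int -> bool) : Prop :=
  exists M j, forall x, chi x = (M.+1%:Z %| x - j)%Z.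

Definition Rcol (chi : int -> bool) : Prop :=
  exists M u d j, forall x, chi x = (M.+1%:Z %| (r (idx x - d + u))%:Z - j)%Z.

Definition inZ (x : int) : Prop := True.
Definition inR (x : int) : Prop := exists n, x = (r n)%:Z.

Lemma inR_idx x : inR x -> x = (r (idx x))%:Z.
Proof. by case=> n ->; rewrite idx_r. Qed.

Definition ztame V (T : int -> int -> (V -> int) -> Prop) := tame inZ Zcol T.
Definition rtame V (T : int -> int -> (V -> int) -> Prop) := tame inR Rcol T.

Lemma ztame_bounded V (T : int -> int -> (V -> int) -> Prop) :
  ztame T ->
  exists (F : seq (tm V)) q, (0 < q)%N /\ forall (x x' : int) e,
    (q%:Z %| x - x')%Z ->
    (forall f, List.In f F -> (x < tev e f) = (x' < tev e f)) -> T x x' e.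
Proof.
move=> tT; have := @tame_bounded inZ Zcol V (fun q x x' => (q%:Z %| x - x')%Z) T.
case=> //.
- move=> chi [M [j Hchi]]; exists M.+1 => // x x' _ _ dvd_x; rewrite !Hchi.
  have -> : x - j = (x - x') + (x' - j) by ring.
  exact: rpredDl dvd_x.
- move=> p q x x' _ _; rewrite PoszM => dvd_x.
  by split; apply: dvdz_trans dvd_x; [exact: dvdz_mulr | exact: dvdz_mull].
by move=> F [q [q0 H]]; exists F, q; split=> // x x' e; exact: H.
Qed.

Hypothesis r_periodic : cong_periodic_enum r.

(** By congruence-periodicity, colours on R are eventually periodic in the index. The number [q] is
    both a common period and a threshold past which periodicity holds. *)
Lemma rtame_bounded V (T : int -> int -> (V -> int) -> Prop) :
  rtame T ->
  exists (F : seq (tm V)) q, (0 < q)%N /\ forall n n' e,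
    (q <= n)%N -> (q <= n')%N -> n = n' %[mod q] ->
    (forall f, List.In f F ->
       ((r n)%:Z < tev e f) = ((r n')%:Z < tev e f)) -> T (r n) (r n') e.
Proof.
pose eqv q x x' := [/\ (q <= idx x)%N, (q <= idx x')%N & idx x = idx x' %[mod q]].
move=> tT; have := @tame_bounded inR Rcol V eqv T; case=> //.
- move=> chi [M [u [d [j Hchi]]]].
  have [N [p [p0 per]]] := r_periodic (ltn0Sn M).
  have perk k n : (N <= n)%N -> r (n + k * p) = r n %[mod M.+1].
    move=> le_n; elim: k => [|k IH]; first by rewrite addn0.
    by rewrite mulSn addnA addnAC per ?IH //; lia.
  have perm m n : (N <= m)%N -> (m <= n)%N -> m = n %[mod p] ->
      r m = r n %[mod M.+1].
    move=> le_m le_mn /eqP; rewrite eq_sym eqn_mod_dvd // => /dvdnP[k].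
    by move=> Ek; have -> : n = (m + k * p)%N by [lia]; rewrite perk.
  have perd m n : (N <= m)%N -> (N <= n)%N -> m = n %[mod p] ->
      r m = r n %[mod M.+1].
    by case: (leqP m n) => [|/ltnW] le_mn le_m le_n E; [|symmetry]; apply: perm.
  (* A multiple of the period [p] larger than N + d, so that indices shifted back by [d] are still
     in the periodic range. *)
  exists (p * (N + d).+1)%N; first by rewrite muln_gt0 p0.
  move=> x x' _ _ [le_x le_x' E]; rewrite !Hchi.
  have E' : idx x = idx x' %[mod p].
    have /eqP := E; case: (leqP (idx x) (idx x')) => [le_xx|/ltnW le_xx].
      rewrite eq_sym eqn_mod_dvd // => /(dvdn_trans (dvdn_mulr _ (dvdnn p))).
      by rewrite -eqn_mod_dvd // eq_sym => /eqP.
    rewrite eqn_mod_dvd // => /(dvdn_trans (dvdn_mulr _ (dvdnn p))).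
    by rewrite -eqn_mod_dvd // => /eqP.
  have le_pN : (N + d < p * (N + d).+1)%N by rewrite leq_pmull.
  have E2 : r (idx x - d + u) = r (idx x' - d + u) %[mod M.+1].
    apply: perd; [lia|lia|].
    apply/eqP; rewrite -(eqn_modDr d) addnAC subnK; last by lia.
    by rewrite addnAC subnK ?eqn_modDr ?E' //; lia.
  have : (M.+1%:Z %| (r (idx x - d + u))%:Z - (r (idx x' - d + u))%:Z)%Z.
    by rewrite -eqz_mod_dvd /= !modz_nat E2.
  set a := Posz _; set b := Posz _ => dvd_ab.
  have -> : a - j = (a - b) + (b - j) by ring.
  exact: rpredDl dvd_ab.
- move=> p q x x' p0 q0 [le_x le_x' E].
  have [le_p le_q] : (p <= p * q)%N /\ (q <= p * q)%N.
    by rewrite leq_pmulr // leq_pmull.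
  split; split; try lia.
    by rewrite -(modn_dvdm (idx x) (dvdn_mulr q (dvdnn p))) E modn_dvdm ?dvdn_mulr.
  by rewrite -(modn_dvdm (idx x) (dvdn_mull p (dvdnn q))) E modn_dvdm ?dvdn_mull.
move=> F [q [q0 H]]; exists F, q; split=> // n n' e le_n le_n' E HF.
by apply: H HF; [exists n | exists n' | split; rewrite !idx_r].
Qed.

(** Take a witness of least absolute value. If this value is at least [q], moving the witness by [q]
    towards 0 destroys it, so a cut lies within distance [q]. Hence some witness is within [q] of 0
    or of a cut. *)
Lemma def_ex_ztame V (f : qf (option V)) :
  ztame (fun x x' e => qev (ext x e) f = qev (ext x' e) f) ->
  def (fun e => exists x, qev (ext x e) f).
Proof.
move=> /ztame_bounded[F [q [q0 HF]]].
apply: def_iff (def_exists_in (Cst 0 :: F) (fun g => def_exists_lt (q + q).+1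
  (fun k => def_qf (qsub (inst (Add g (Cst (k%:Z - q%:Z)))) f)))) => e.
split=> [[g [_ [k _]]]|[x0 Hx0]].
  by rewrite qev_inst; exists (tev e (Add g (Cst (k%:Z - q%:Z)))).
have cand g (x : int) : List.In g (Cst 0 :: F) -> `|x - tev e g| <= q%:Z ->
    qev (ext x e) f -> exists i, List.In i (Cst 0 :: F) /\
    exists2 k, (k < (q + q).+1)%N & qev e (qsub (inst (Add i (Cst (k%:Z - q%:Z)))) f).
  move=> Fg lt_x Hx; exists g; split=> //.
  exists (absz (x - tev e g + q%:Z)); first by lia.
  rewrite qev_inst /=.
  by have -> : tev e g + (Posz (absz (x - tev e g + q%:Z)) - q%:Z) = x by lia.
have ex_n : exists n, qev (ext (Posz n) e) f || qev (ext (- Posz n) e) f.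
  by exists `|x0|%N; case: x0 Hx0 => n //= ->; rewrite ?orbT.
have [n Hn min_n] := ex_minnP ex_n.
have min_x (x : int) : qev (ext x e) f -> (n <= `|x|)%N.
  by move=> Hx; apply: min_n; case: x Hx => m //= ->; rewrite ?orbT.
have step (x x' : int) : qev (ext x e) f -> ~~ qev (ext x' e) f -> (q%:Z %| x - x')%Z ->
    exists2 g, List.In g F & (x < tev e g) != (x' < tev e g).
  move=> Hx Hx' dvd_x; have := HF x x' e dvd_x.
  case: (List.Exists_dec (fun g => (x < tev e g) != (x' < tev e g)) F).
  - by move=> g; case: (_ != _); [left | right].
  - by move/List.Exists_exists=> [g [Fg ne]] _; exists g.
  move=> nex H; move: Hx; rewrite H ?(negbTE Hx') // => g Fg; apply/eqP.
  by apply/negPn/negP => ne; apply: nex; apply/List.Exists_exists; exists g.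
have [x Hx ax] : exists2 x, qev (ext x e) f & (`|x| = n)%N.
  by case/orP: Hn => Hx; [exists (Posz n) | exists (- Posz n)] => //; lia.
case: (ltnP n q) => [lt_n|le_n].
  by apply: (cand (Cst 0) x) => //=; [left | lia].
case: (lerP 0 x) => x0'.
  have Hx' : ~~ qev (ext (x - q%:Z) e) f.
    by apply/negP => /min_x; lia.
  have [|g Fg ne] := step _ _ Hx Hx'; first by rewrite opprB addrC subrK.
  by apply: (cand g x) => //=; [right | lia].
have Hx' : ~~ qev (ext (x + q%:Z) e) f.
  by apply/negP => /min_x; lia.
have [|g Fg ne] := step _ _ Hx Hx'; first by rewrite opprD addNKr dvdzE abszN dvdnn.
by apply: (cand g x) => //=; [right | lia].
Qed.

(** Let r_n be the least witness. If n >= 2q, then n - q is still past the threshold [q] and is not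
    a witness, so a cut lies in the interval from r_{n-q} to r_n, and r_n is at most [q] steps above
    its index. *)
Lemma def_ex_rtame V (f : qf (option V)) :
  rtame (fun x x' e => qev (ext x e) f = qev (ext x' e) f) ->
  def (fun e => exists n, qev (ext (r n)%:Z e) f).
Proof.
move=> /rtame_bounded[F [q [q0 HF]]].
apply: def_iff (def_or
  (def_exists_lt (q + q) (fun k => def_qf (qsub (inst (Cst (r k)%:Z)) f)))
  (def_exists_in F (fun g => def_exists_lt q.+1
    (fun k => def_qf (qsub (inst (TR k 0 g)) f))))) => e.
split=> [[[k _]|[g [_ [k _]]]]|ex_n]; rewrite ?qev_inst.
- by exists k.
- by exists (idx (tev e g) - 0 + k)%N.
have [n Hn min_n] := ex_minnP ex_n.
case: (ltnP n (q + q)) => [lt_n|le_n].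
  by left; exists n => //; rewrite qev_inst.
have Hn' : ~~ qev (ext (r (n - q))%:Z e) f by apply/negP => /min_n; lia.
have : n - q = n %[mod q] by rewrite -[in RHS](@subnK q n) ?modnDr //; lia.
move/(HF (n - q)%N n e) => {}HF; right.
case: (List.Exists_dec (fun g =>
    ((r (n - q))%:Z < tev e g) != ((r n)%:Z < tev e g)) F).
- by move=> g; case: (_ != _); [left | right].
- move/List.Exists_exists=> [g [Fg ne]]; exists g; split=> //.
  have lt_r : (r (n - q) < r n)%N by apply: ltn_r; lia.
  have [lt_g le_g] : (r (n - q))%:Z < tev e g /\ tev e g <= (r n)%:Z by lia.
  have g_le : (n - q <= idx (tev e g))%N by apply: idx_ge; lia.
  have g_ge : (idx (tev e g) <= n)%N by rewrite idx_leP; have := r_incr n; lia.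
  exists (n - idx (tev e g))%N; first by lia.
  by rewrite qev_inst /= subn0 subnKC.
move=> nex; suff E : qev (ext (r (n - q))%:Z e) f = qev (ext (r n)%:Z e) f.
  by move: Hn'; rewrite E Hn.
apply: HF; [lia|lia|move=> g Fg; apply/eqP/negPn/negP => ne].
by apply: nex; apply/List.Exists_exists; exists g.
Qed.

(** * The rank, and formulas of rank zero over Z *)

Fixpoint has_in V (p : V -> bool) (t : tm V) : bool :=
  match t with
  | Var v => p v
  | Cst _ => false
  | Add t1 t2 => has_in p t1 || has_in p t2
  | Mul _ t1 | Div _ t1 | TR _ _ t1 => has_in p t1
  end.

(* The rank on which quantifier elimination and distality proceed by induction. *)
Fixpoint trn V (p : V -> bool) (t : tm V) : nat :=
  match t with
  | Var _ | Cst _ => 0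
  | Add t1 t2 => trn p t1 + trn p t2
  | Mul _ t1 | Div _ t1 => trn p t1
  | TR _ _ t1 => has_in p t1 + trn p t1
  end.

Fixpoint qtrn V (p : V -> bool) (f : qf V) : nat :=
  match f with
  | Pos t => trn p t
  | Not g => qtrn p g
  | And g h => qtrn p g + qtrn p h
  end.

Lemma trn_has V (p : V -> bool) t : ~~ has_in p t -> trn p t = 0%N.
Proof.
elim: t => //= [t1 IH1 t2 IH2|u d t IH hx]; last by rewrite (negbTE hx) IH.
by rewrite negb_or => /andP[/IH1 -> /IH2 ->].
Qed.

Lemma tev_has V (p : V -> bool) (e e' : V -> int) t :
  (forall v, ~~ p v -> e v = e' v) -> ~~ has_in p t -> tev e t = tev e' t.
Proof.
move=> ee'; elim: t => //= [t1 IH1 t2 IH2|c t IH /IH ->|d t IH /IH ->|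
  u d t IH /IH ->] //.
by rewrite negb_or => /andP[/IH1 -> /IH2 ->].
Qed.

Lemma has_sub V W (p : V -> bool) (p' : W -> bool) (s : V -> tm W) t :
  (forall v, has_in p' (s v) = p v) -> has_in p' (tsub s t) = has_in p t.
Proof. by move=> Hs; elim: t => //= t1 -> t2 ->. Qed.

Lemma trn_sub V W (p : V -> bool) (p' : W -> bool) (s : V -> tm W) t :
  (forall v, has_in p' (s v) = p v) -> (forall v, trn p' (s v) = 0%N) ->
  trn p' (tsub s t) = trn p t.
Proof.
move=> Hs Hs0; elim: t => //= [t1 -> t2 ->//|u d t ->].
by rewrite (has_sub _ Hs).
Qed.

Lemma qtrn_sub V W (p : V -> bool) (p' : W -> bool) (s : V -> tm W) f :
  (forall v, has_in p' (s v) = p v) -> (forall v, trn p' (s v) = 0%N) ->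
  qtrn p' (qsub s f) = qtrn p f.
Proof.
by move=> Hs Hs0; elim: f => //= [t|g -> h ->//]; exact: trn_sub.
Qed.

Definition isx V (o : option V) : bool := if o is Some _ then false else true.

(** In rank zero no [TR] is applied to [x], so the term is linear up to a periodic part. For
    division by d + 1 the period is multiplied by d + 1, which makes the increment divisible. *)
Lemma tev_periodic V (t : tm (option V)) : trn (@isx V) t = 0%N ->
  exists (M : nat) (c : int), forall (x : int) (e : V -> int),
    tev (ext (x + M.+1%:Z) e) t = tev (ext x e) t + c.
Proof.
elim: t => [[v|] _|a _|t1 IH1 t2 IH2|a t IH /IH|d t IH /IH|u d t _] /=.
- by exists 0%N, 0 => x e; rewrite addr0.
- by exists 0%N, 1.
- by exists 0%N, 0 => x e; rewrite addr0.
- move/eqP; rewrite addn_eq0 => /andP[/eqP/IH1[M [c Hc]] /eqP/IH2[N [d Hd]]].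
  have iter M' (c' : int) (t : tm (option V)) (x : int) (e : V -> int) k :
      (forall (x : int) (e : V -> int),
         tev (ext (x + M'.+1%:Z) e) t = tev (ext x e) t + c') ->
      tev (ext (x + (k * M'.+1)%N%:Z) e) t = tev (ext x e) t + k%:Z * c'.
    move=> H; elim: k => [|k IHk]; first by rewrite mul0n mul0r !addr0.
    rewrite mulSn addnC PoszD addrA H IHk; ring.
  exists (M.+1 * N.+1).-1, (N.+1%:Z * c + M.+1%:Z * d) => x e.
  rewrite prednK ?muln_gt0 // (iter N d t2) // mulnC (iter M c t1) //; ring.
- move=> [M [c Hc]]; exists M, (a * c) => x e; rewrite Hc; ring.
- move=> [M [c Hc]]; exists (d.+1 * M.+1).-1, c => x e.
  rewrite prednK ?muln_gt0 //.
  have -> : tev (ext (x + (d.+1 * M.+1)%N%:Z) e) t = c * d.+1%:Z + tev (ext x e) t.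
    elim: (d.+1) => [|k IHk]; first by rewrite mul0n mulr0 !addr0 add0r.
    rewrite mulSn addnC PoszD addrA Hc IHk; ring.
  by rewrite divzMDl // addrC.
- move/eqP; rewrite addn_eq0 eqb0 => /andP[Ht _]; exists 0%N, 0 => x e.
  rewrite addr0; congr (Posz (r (idx _ - d + u))).
  by apply: tev_has Ht => -[].
Qed.

Lemma tev_periodicZ V (t : tm (option V)) : trn (@isx V) t = 0%N ->
  exists (M : nat) (c : int), forall (x q : int) (e : V -> int),
    tev (ext (q * M.+1%:Z + x) e) t = tev (ext x e) t + q * c.
Proof.
move=> /tev_periodic[M [c Hc]]; exists M, c => x q e.
have Hn x' n : tev (ext (n%:Z * M.+1%:Z + x') e) t = tev (ext x' e) t + n%:Z * c.
  elim: n => [|n IHn]; first by rewrite !mul0r addr0 add0r.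
  have -> : n.+1%:Z * M.+1%:Z + x' = (n%:Z * M.+1%:Z + x') + M.+1%:Z by lia.
  by rewrite Hc IHn -addn1 PoszD; ring.
case: q => n; first exact: Hn.
have := Hn (Negz n * M.+1%:Z + x) n.+1; rewrite !NegzE.
have -> : n.+1%:Z * M.+1%:Z + (- n.+1%:Z * M.+1%:Z + x) = x by ring.
move=> ->; ring.
Qed.

(** On a residue class x = q (M + 1) + k the term is t(k) + q c, monotone in [q], so its sign
    changes at most once. The place of the change is a term free of [x]. *)
Lemma ztame_pos V (t : tm (option V)) : trn (@isx V) t = 0%N ->
  ztame (fun x x' e => (0 < tev (ext x e) t) = (0 < tev (ext x' e) t)).
Proof.
move=> /tev_periodicZ[M [c Hc]].
have tcol (k : nat) : @ztame V (fun x x' e =>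
    (M.+1%:Z %| x - k%:Z)%Z = (M.+1%:Z %| x' - k%:Z)%Z).
  apply: (@tame_col inZ Zcol V (fun x => (M.+1%:Z %| x - k%:Z)%Z)).
  by exists M, k%:Z.
(* With y = t(k): for c > 0 the condition is the negation of q < floor(-y / c) + 1, and for c = -(a
   + 1) it is q < floor((y + a) / (a + 1)), a ceiling. The boolean [b] records the negation. *)
have [cut [b Hcut]] : exists (cut : nat -> tm V) (b : bool),
    c <> 0 -> forall k q e,
    (0 < tev (ext k%:Z e) t + q * c) = b (+) (q < tev e (cut k)).
  case: c {Hc} => [[|a]|a].
  - by exists (fun=> Cst 0), true => /(_ erefl).
  - exists (fun k => Add (Div a (Mul (-1) (tsub (inst (Cst k%:Z)) t))) (Cst 1)).
    exists true => _ k q e /=; rewrite tev_inst /=.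
    have := lez_floor (-1 * tev (ext k e) t) (isT : a.+1%:Z != 0).
    have := ltz_ceil (-1 * tev (ext k e) t) (isT : 0 < a.+1%:Z).
    move: (_ %/ _)%Z => w; move: (tev _ _) => y; nia.
  - exists (fun k => Div a (Add (tsub (inst (Cst k%:Z)) t) (Cst a%:Z))).
    exists false => _ k q e /=; rewrite tev_inst /= NegzE.
    have := lez_floor (tev (ext k e) t + a%:Z) (isT : a.+1%:Z != 0).
    have := ltz_ceil (tev (ext k e) t + a%:Z) (isT : 0 < a.+1%:Z).
    move: (_ %/ _)%Z => w; move: (tev _ _) => y; nia.
have tcut (k : nat) := @tame_cut inZ Zcol V
  (Add (Mul M.+1%:Z (cut k)) (Cst k%:Z)).
refine (tame_mono2 (tame_all (m := M.+1) (fun k _ => tcol k))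
  (tame_all (m := M.+1) (fun k _ => tcut k)) _) => x x' e _ _ {tcol tcut} Hcol Hcut'.
have [k lt_k Ex] : exists2 k, (k < M.+1)%N & (x %% M.+1%:Z)%Z = k%:Z.
  exists (absz (x %% M.+1%:Z)%Z); first by lia.
  by rewrite gez0_abs // modz_ge0.
have Ex1 := divz_eq x M.+1%:Z; rewrite Ex in Ex1.
have : (M.+1%:Z %| x' - k%:Z)%Z.
  by rewrite -Hcol // Ex1 addrK dvdz_mull.
case/dvdzP=> q' Eq'; have {Eq'} Ex' : x' = q' * M.+1%:Z + k%:Z by lia.
move: (Hcut' k lt_k); rewrite Ex1 Ex' /= !Hc.
move: (x %/ M.+1%:Z)%Z => q.
have [->|/eqP c0] := eqVneq c 0; first by rewrite !mulr0.
rewrite !Hcut // => E; congr (b (+) _).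
by move: (tev e (cut k)) E => w; rewrite ![_ * M.+1%:Z]mulrC !ltrD2r !ltr_pM2l.
Qed.

Lemma ztame_qf V (f : qf (option V)) : qtrn (@isx V) f = 0%N ->
  ztame (fun x x' e => qev (ext x e) f = qev (ext x' e) f).
Proof.
elim: f => [t|g IH|g IHg h IHh] /=; first exact: ztame_pos.
  by move=> /IH Hg; refine (tame_mono Hg _) => x x' e _ _ ->.
move/eqP; rewrite addn_eq0 => /andP[/eqP/IHg Hg /eqP/IHh Hh].
by refine (tame_mono2 Hg Hh _) => x x' e _ _ -> ->.
Qed.

(** * Comparisons and congruences over R *)

Lemma rtame_point V (c : tm V) T :
  rtame (fun x x' e => x = tev e c -> x' = tev e c -> T x x' e) ->
  rtame (fun x x' e => [/\ (x < tev e c) = (x' < tev e c),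
    x = tev e c -> T x x' e & x' = tev e c -> T x x' e]).
Proof.
move=> H; refine (tame_mono2 (tame_and (tame_cut inR Rcol c)
  (tame_cut inR Rcol (Add c (Cst 1)))) H _) => x x' e _ _ /= [E1 E2] HT.
by split=> // Ex; apply: HT; lia.
Qed.

(** The two zones in which one of [x] and [s] dominates the other by [K] steps of R; they are chosen
    so that no operator in [x] can cancel against [s]. *)
Definition above K (s x : int) : Prop :=
  (K <= idx x)%N /\ `|s| < (r (idx x - K))%:Z.
Definition below K (s x : int) : Prop :=
  (K <= idx x)%N /\ (r (idx x + K))%:Z <= `|s|.

(* The elements of R that are neither above nor below |s| are finitely many
   terms in s, so cuts at these terms single them out. *)
Lemma rtame_zones V (s : tm V) K T :
  (forall c : tm V,
     rtame (fun x x' e => x = tev e c -> x' = tev e c -> T x x' e)) ->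
  rtame (fun x x' e => above K (tev e s) x -> above K (tev e s) x' -> T x x' e) ->
  rtame (fun x x' e => below K (tev e s) x -> below K (tev e s) x' -> T x x' e) ->
  rtame T.
Proof.
move=> Hpt Hab Hbe.
(* The absolute value is not a term, so both signs of [s] are listed; [b] selects the one that gives
   |s|. *)
pose p (b k : nat) := TR k K (Mul (if b is 0%N then 1 else -1) s).
have H1 := tame_all (m := 2) (fun b _ =>
  tame_all (m := (K + K).+3) (fun k _ => rtame_point (Hpt (p b k)))).
have H2 := tame_all (m := K) (fun k _ => rtame_point (Hpt (Cst (r k)%:Z))).
refine (tame_mono2 (tame_and H1 H2) (tame_and Hab Hbe) _).
move=> x x' e Rx Rx' [{}H1 {}H2] [{}Hab {}Hbe].
have Ex := inR_idx Rx; have Ex' := inR_idx Rx'.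
case: (ltnP (idx x) K) => [lt_x|le_x].
  by have [_ HT _] := H2 _ lt_x; apply: HT.
case: (ltnP (idx x') K) => [lt_x'|le_x'].
  by have [_ _ HT] := H2 _ lt_x'; apply: HT.
have [b lt_b Eb] : exists2 b, (b < 2)%N &
    (if b is 0%N then 1 else -1) * tev e s = `|tev e s|.
  by case: (lerP 0 (tev e s)) => h; [exists 0%N | exists 1%N] => //; lia.
have Ep k : tev e (p b k) = (r (idx `|tev e s| - K + k))%:Z by rewrite /= Eb.
set i := idx `|tev e s| in Ep.
have zone y : (i - K <= idx y < i - K + (K + K).+2)%N ->
    exists2 k, (k < (K + K).+3)%N & (r (idx y))%:Z = tev e (p b k).
  by move=> ineq; exists (idx y - (i - K))%N; [lia | rewrite Ep subnKC //; lia].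
case: (boolP (i - K <= idx x < i - K + (K + K).+2)%N) => [/zone[k lt_k]|out].
  by rewrite -Ex => Ek; have [_ HT _] := H1 b lt_b k lt_k; exact: HT.
case: (boolP (i - K <= idx x' < i - K + (K + K).+2)%N) => [/zone[k lt_k]|out'].
  by rewrite -Ex' => Ek; have [_ _ HT] := H1 b lt_b k lt_k; exact: HT.
have E0 : (x < tev e (p b 0%N)) = (x' < tev e (p b 0%N)).
  by have [-> _ _] := H1 b lt_b 0%N isT.
have lt_p y : inR y -> (y < tev e (p b 0%N)) = (idx y < i - K)%N.
  by move=> /inR_idx Ey; rewrite Ep addn0 {1}Ey ltz_nat !ltnNge leq_r.
rewrite !lt_p // in E0.
have ab y : (K <= idx y)%N -> (i - K + (K + K).+2 <= idx y)%N -> above K (tev e s) y.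
  move=> le_y ge_y; split=> //; have := idx_lt `|tev e s|; rewrite -/i => lt_i.
  by apply: lt_le_trans lt_i _; rewrite lez_nat leq_r; lia.
have be y : (K <= idx y)%N -> (idx y < i - K)%N -> below K (tev e s) y.
  move=> le_y lt_y; split=> //; apply: (@le_trans _ _ (r i)%:Z).
    by rewrite lez_nat leq_r; lia.
  by apply: idx_pos; rewrite -/i; lia.
case: (ltnP (idx x) (i - K)) => [lt_x|ge_x].
  by apply: Hbe; apply: be => //; rewrite -E0.
by apply: Hab; apply: ab => //; lia.
Qed.

Lemma opfun_ext f g N :
  (forall n, (N <= n)%N -> f n = g n) -> opfun f -> opfun g.
Proof.
move=> fg [J [p Hp]]; exists (N + J)%N, ('X^N * p) => n le_n.
rewrite op_atXn -fg ?Hp; try lia.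
by congr (op_at r _ _); lia.
Qed.

(** Where [s] dominates, the sum has the sign of [s]. Where [x] dominates, it has the eventual sign
    of [g], or that of [s] if [g] is eventually zero. The remaining points are isolated by cuts. *)
Lemma rtame_cmp V g (s : tm V) : opfun g ->
  rtame (fun x x' e =>
    (0 < g (idx x) + tev e s) = (0 < g (idx x') + tev e s)).
Proof.
move=> og; have [d' [N Hb]] := opfun_bound og.
have sgn_below K x (y : int) : (N + d' < K)%N -> below K y x ->
    (0 < g (idx x) + y) = (0 < y).
  move=> lt_K [le_x le_y].
  have := Hb (idx x); have := @ltn_r (idx x + d') (idx x + K); lia.
have rec K : (N + d' < K)%N ->
    (forall x x' y, above K y x -> above K y x' ->
       (0 < g (idx x) + y) = (0 < g (idx x') + y)) ->
    rtame (fun x x' (e : V -> int) =>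
      (0 < g (idx x) + tev e s) = (0 < g (idx x') + tev e s)).
  move=> lt_K H; apply: (rtame_zones (s := s) (K := K)) => [c||].
  - by apply: tame_const => x x' e _ _ -> ->.
  - by apply: tame_const => x x' e _ _; exact: H.
  - by apply: tame_const => x x' e _ _ hx hx'; rewrite !(sgn_below K).
case: (opfun_trichotomy og) => [[N0 g0]|[d Hd]|[d Hd]].
- apply: (rec (N + d' + N0).+1) => [|x x' y [le_x _] [le_x' _]]; first by lia.
  by rewrite !g0; lia.
- apply: (rec (N + d' + d).+1) => [|x x' y [le_x lt_x] [le_x' lt_x']]; first by lia.
  have := Hd (idx x); have := @ltn_r (idx x - (N + d' + d).+1) (idx x - d).
  have := Hd (idx x'); have := @ltn_r (idx x' - (N + d' + d).+1) (idx x' - d).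
  lia.
- apply: (rec (N + d' + d).+1) => [|x x' y [le_x lt_x] [le_x' lt_x']]; first by lia.
  have := Hd (idx x); have := @ltn_r (idx x - (N + d' + d).+1) (idx x - d).
  have := Hd (idx x'); have := @ltn_r (idx x' - (N + d' + d).+1) (idx x' - d).
  lia.
Qed.

(** Past some index the residue of [g] is computed from finitely many colours. The zones for s = 0
    dispose of the finitely many smaller indices, which are isolated by cuts. *)
Lemma rtame_cong V g (M : nat) : opfun g ->
  rtame (fun x x' (e : V -> int) => (M.+1%:Z %| g (idx x) - g (idx x'))%Z).
Proof.
move=> /(opfun_cong M.+1)[J [K [N H]]].
pose col i j x := (M.+1%:Z %| (r (idx x - J + i))%:Z - j%:Z)%Z.
have tcol i j : @rtame V (fun x x' e => col i j x = col i j x').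
  by apply: tame_col; exists M, i, J, j%:Z.
have Hcol := tame_all (m := K) (fun i _ => tame_all (m := M.+1) (fun j _ => tcol i j)).
have big : rtame (fun x x' (e : V -> int) => (N <= idx x)%N -> (N <= idx x')%N ->
    (M.+1%:Z %| g (idx x) - g (idx x'))%Z).
  refine (tame_mono Hcol _) => x x' e _ _ {}Hcol le_x le_x'.
  apply: H => // i lt_i.
  have := Hcol i lt_i (r (idx x - J + i) %% M.+1)%N (ltn_pmod _ (ltn0Sn M)).
  rewrite /col -!eqz_mod_dvd !modz_nat modn_mod eqxx => /esym/eqP E.
  by apply/eqP; rewrite E.
apply: (rtame_zones (s := Cst 0) (K := N)) => [c||].
- by apply: tame_const => x x' e _ _ -> ->; rewrite subrr dvdz0.
- by refine (tame_mono big _) => x x' e _ _ HT [le_x _] [le_x' _]; apply: HT.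
- by refine (tame_mono big _) => x x' e _ _ HT [le_x _] [le_x' _]; apply: HT.
Qed.

(** * Terms in an element of R *)

Definition linform V D (g : nat -> int) (s : tm V) (t : tm (option V)) x e : Prop :=
  D.+1%:Z * tev (ext x e) t = g (idx x) + tev e s.

Lemma divz_mul_nat (a : int) (d m : nat) :
  ((a %/ d.+1%:Z)%Z = ((m.+1%:Z * a) %/ (m.+1 * d.+1)%N%:Z)%Z).
Proof. by rewrite PoszM divzMpl. Qed.

(** Where [s] dominates, t is negative or its index is near that of [s]. Where [x] dominates, t is
    free of [x], or has index near that of [x], or is negative, according to the eventual sign of
    [g]. In each case finitely many comparisons determine the value of [TR], which is again a linear
    form. *)
Lemma rtame_linform_TR V (t : tm (option V)) D g (s : tm V) u d T :
  opfun g ->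
  (forall D' g' s', opfun g' -> rtame (fun x x' e =>
     linform D' g' s' (TR u d t) x e -> linform D' g' s' (TR u d t) x' e ->
     T x x' e)) ->
  rtame (fun x x' e => linform D g s t x e -> linform D g s t x' e -> T x x' e).
Proof.
move=> og H; pose val x e := tev (ext x e) (TR u d t).
have Hw (w : tm V) : rtame (fun x x' e =>
    val x e = tev e w -> val x' e = tev e w -> T x x' e).
  refine (tame_mono (H 0%N (fun=> 0) w opfun0) _) => x x' e _ _ HT Ex Ex'.
  by apply: HT; rewrite /linform mul1r add0r.
have Hpt (c : tm V) : rtame (fun x x' e =>
    x = tev e c -> x' = tev e c -> linform D g s t x e ->
    linform D g s t x' e -> T x x' e).
  refine (tame_mono (Hw (tsub (inst c) (TR u d t))) _).
  move=> x x' e _ _ HT Ex Ex' _ _.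
  by apply: HT; rewrite tev_inst; [rewrite -Ex | rewrite -Ex'].
(* A negative [t] has the default index 0, as the constant -1 has. *)
have neg : rtame (fun x x' e =>
    tev (ext x e) t < 0 -> tev (ext x' e) t < 0 -> T x x' e).
  refine (tame_mono (Hw (TR u d (Cst (-1)))) _) => x x' e _ _ HT lt_x lt_x'.
  by apply: HT; rewrite /val /= !idx_neg.
have tge h (s' : tm V) : opfun h -> rtame (fun x x' e =>
    (h (idx x) <= g (idx x) + tev e s') = (h (idx x') <= g (idx x') + tev e s')).
  move=> oh; have oh' := opfunD og (opfunZ (-1) oh).
  refine (tame_mono (rtame_cmp (Add s' (Cst 1)) oh') _) => x x' e _ _ /=.
  by lia.
have [d' [N Hb]] := opfun_bound og.
have [d2 Hd2] := r_growth 2.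
have [dm Hdm] := idx_mul (2 * D.+1).
have [dn Hdn] := idx_mul 2.
have HbelowT K : (N + d' + d2 + dm + dn < K)%N -> rtame (fun x x' e =>
    below K (tev e s) x -> below K (tev e s) x' ->
    linform D g s t x e -> linform D g s t x' e -> T x x' e).
  move=> lt_K; pose I := (dm + dn)%N; pose c i := TR i I s.
  have tcand i : rtame (fun x x' e =>
      (0 <= g (idx x) + (tev e s + - D.+1%:Z * tev e (c i))) =
      (0 <= g (idx x') + (tev e s + - D.+1%:Z * tev e (c i)))).
    exact: (tge (fun=> 0) (Add s (Mul (- D.+1%:Z) (c i))) opfun0).
  have Hcand := tame_all (m := (I + I).+2) (fun i _ => tcand i).
  have Hcase := tame_all (m := (I + I).+1) (fun i _ => Hw (TR u d (c i))).
  refine (tame_mono2 (tame_and Hcand Hcase) neg _).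
  move=> x x' e _ _ [{}Hcand {}Hcase] {}Hneg bx bx' Ex Ex'.
  have est y : below K (tev e s) y -> linform D g s t y e ->
      `|g (idx y)| * 2 <= `|tev e s| /\ (idx y + K <= idx `|tev e s|)%N.
    move=> [le_y le_s] Ey; split; last exact: idx_ge.
    have := Hb (idx y); have := Hd2 (idx y + d')%N.
    have := leq_r (idx y + d' + d2) (idx y + K); lia.
  have [gx ix] := est _ bx Ex; have [gx' ix'] := est _ bx' Ex'.
  have D0 : 0 < D.+1%:Z by [].
  have [s_lt0|s_ge0] := ltrP (tev e s) 0.
    by apply: Hneg; rewrite -(pmulr_rlt0 _ D0) ?Ex ?Ex'; lia.
  rewrite (ger0_norm s_ge0) in gx gx' ix ix'.
  (* Here |g| <= s / 2, so (D + 1) t lies between s / 2 and 3 s / 2. *)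
  have idx_t y : linform D g s t y e -> `|g (idx y)| * 2 <= tev e s ->
      (idx (tev e s) <= idx (tev (ext y e) t) + dm)%N /\
      (idx (tev (ext y e) t) <= idx (tev e s) + dn)%N.
    move=> Ey gy; split; first by apply: Hdm; rewrite PoszM -mulrA Ey; lia.
    apply: Hdn; apply: (@le_trans _ _ (D.+1%:Z * tev (ext y e) t)).
      by rewrite ler_peMl //; rewrite -(pmulr_rge0 _ D0) Ey; lia.
    by rewrite Ey; lia.
  have [i1 i2] := idx_t _ Ex gx.
  (* The position of t in the window. Comparison with the candidates [i] and [i.+1] puts the value
     of t at [x'] between the same two consecutive elements of R. *)
  pose i := (idx (tev (ext x e) t) - (idx (tev e s) - I))%N.
  have lt_i : (i < (I + I).+1)%N by lia.
  have Ei : idx (tev (ext x e) t) = (idx (tev e s) - I + i)%N by lia.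
  have le_t : D.+1%:Z * tev e (c i) <= g (idx x) + tev e s.
    by rewrite -Ex ler_pM2l //= -Ei; apply: idx_pos; lia.
  have lt_t : g (idx x) + tev e s < D.+1%:Z * tev e (c i.+1).
    by rewrite -Ex ltr_pM2l //= addnS -Ei; apply: idx_lt.
  have := Hcand i (ltnW lt_i); have := Hcand i.+1 lt_i; rewrite /= !addrA.
  move=> E1 E2.
  have le_t' : tev e (c i) <= tev (ext x' e) t.
    by rewrite -(ler_pM2l D0) Ex'; move: E2 le_t => /=; lia.
  have lt_t' : tev (ext x' e) t < tev e (c i.+1).
    by rewrite -(ltr_pM2l D0) Ex'; move: E1 lt_t => /=; lia.
  apply: (Hcase i lt_i); rewrite /val /c /= idx_r; first by rewrite Ei.
  rewrite (@eq_idx _ (idx (tev e s) - I + i)%N) //; last by left.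
  by rewrite -addnS.
have rec K : (N + d' + d2 + dm + dn < K)%N ->
    rtame (fun x x' e => above K (tev e s) x -> above K (tev e s) x' ->
      linform D g s t x e -> linform D g s t x' e -> T x x' e) ->
    rtame (fun x x' e => linform D g s t x e -> linform D g s t x' e -> T x x' e).
  move=> lt_K Hab; apply: (rtame_zones (s := s) (K := K)) => //.
  exact: HbelowT.
case: (opfun_trichotomy og) => [[N0 g0]|[dg Hg]|[dg Hg]].
- apply: (rec (N + d' + d2 + dm + dn + N0).+1); first by lia.
  refine (tame_mono (Hw (TR u d (Div D s))) _).
  move=> x x' e _ _ HT [le_x _] [le_x' _]; rewrite /linform !g0; try lia.
  rewrite !add0r => Ex Ex'.
  by apply: HT; rewrite /val /=; [rewrite -Ex | rewrite -Ex']; rewrite mulKz.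
- pose I := (dg + d' + dm + dn)%N.
  (* [K] exceeds I + d, so the backward shifts by [I] and by [d] are not truncated and combine into
     one. *)
  pose K := (N + d' + d2 + dm + dn + dg + I + d).+1.
  apply: (rec K); first by lia.
  have tcand i : rtame (fun x x' e =>
      (D.+1%:Z * (r (idx x - I + i))%:Z <= g (idx x) + tev e s) =
      (D.+1%:Z * (r (idx x' - I + i))%:Z <= g (idx x') + tev e s)).
    exact: (tge (fun n => D.+1%:Z * (r (n - I + i))%:Z) s (opfunZ _ (opfun_r i I))).
  have tcase i : rtame (fun x x' e => (I + d <= idx x)%N -> (I + d <= idx x')%N ->
      val x e = (r (idx x - I + i - d + u))%:Z ->
      val x' e = (r (idx x' - I + i - d + u))%:Z -> T x x' e).
    have og' : opfun (fun n => (r (n - I + i - d + u))%:Z).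
      apply: (opfun_ext (N := (I + d)%N) _ (opfun_r (i + u) (I + d))) => n le_n.
      by congr (Posz (r _)); lia.
    refine (tame_mono (H 0%N _ (Cst 0) og') _) => x x' e _ _ HT _ _ Ex Ex'.
    by apply: HT; rewrite /linform mul1r addr0.
  have Hcand := tame_all (m := (I + I).+2) (fun i _ => tcand i).
  have Hcase := tame_all (m := (I + I).+1) (fun i _ => tcase i).
  refine (tame_mono2 Hcand Hcase _) => x x' e _ _ {}Hcand {}Hcase ax ax' Ex Ex'.
  have D0 : 0 < D.+1%:Z by [].
  have [le_x lt_x] := ax; have [le_x' _] := ax'.
  have sx : 2 * `|tev e s| <= (r (idx x - dg))%:Z.
    have := Hd2 (idx x - K)%N; have := leq_r (idx x - K + d2) (idx x - dg).
    have -> : (idx x - K + d2 <= idx x - dg)%N by lia.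
    by lia.
  have gx := Hg (idx x); have gx' := Hb (idx x).
  have i1 : (idx x - dg <= idx (tev (ext x e) t) + dm)%N.
    rewrite -[(idx x - dg)%N]idx_r; apply: Hdm.
    by rewrite PoszM -mulrA Ex; lia.
  have i2 : (idx (tev (ext x e) t) <= idx x + d' + dn)%N.
    rewrite -[(idx x + d')%N]idx_r; apply: Hdn.
    apply: (@le_trans _ _ (D.+1%:Z * tev (ext x e) t)).
      by rewrite ler_peMl // -(pmulr_rge0 _ D0) Ex; lia.
    have := leq_r (idx x - dg) (idx x + d').
    have -> : (idx x - dg <= idx x + d')%N by lia.
    by rewrite Ex; lia.
  pose i := (idx (tev (ext x e) t) - (idx x - I))%N.
  have lt_i : (i < (I + I).+1)%N by lia.
  have Ei : idx (tev (ext x e) t) = (idx x - I + i)%N by lia.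
  have le_t : D.+1%:Z * (r (idx x - I + i))%:Z <= g (idx x) + tev e s.
    by rewrite -Ex ler_pM2l //= -Ei; apply: idx_pos; lia.
  have lt_t : g (idx x) + tev e s < D.+1%:Z * (r (idx x - I + i.+1))%:Z.
    by rewrite -Ex ltr_pM2l //= addnS -Ei; apply: idx_lt.
  have le_t' : (r (idx x' - I + i))%:Z <= tev (ext x' e) t.
    by rewrite -(ler_pM2l D0) Ex' -Hcand // ltnW.
  have lt_t' : tev (ext x' e) t < (r (idx x' - I + i.+1))%:Z.
    by rewrite -(ltr_pM2l D0) Ex' ltNge -Hcand // -ltNge.
  apply: (Hcase i lt_i); rewrite /val /=; try lia; first by rewrite Ei.
  rewrite (@eq_idx _ (idx x' - I + i)%N) //; last by left.
  by rewrite -addnS.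
- apply: (rec (N + d' + d2 + dm + dn + dg).+1); first by lia.
  refine (tame_mono neg _) => x x' e _ _ Hneg ax ax' Ex Ex'.
  have D0 : 0 < D.+1%:Z by [].
  have lt0 y : above (N + d' + d2 + dm + dn + dg).+1 (tev e s) y ->
      g (idx y) + tev e s < 0.
    move=> [le_y lt_y]; have := Hg (idx y).
    have := @ltn_r (idx y - (N + d' + d2 + dm + dn + dg).+1) (idx y - dg).
    lia.
  by apply: Hneg; rewrite -(pmulr_rlt0 _ D0) ?Ex ?Ex' lt0.
Qed.
(* Up to cuts and colours, a term in an element of R is a linear form in an
   operator: the proof of a tameness statement may assume such a form. *)
Lemma rtame_linform V (t : tm (option V)) T :
  (forall D g s, opfun g -> rtame (fun x x' e =>
     linform D g s t x e -> linform D g s t x' e -> T x x' e)) ->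
  rtame T.
Proof.
elim: t T => [[v|]|c|t1 IH1 t2 IH2|c t IH|d t IH|u d t IH] T H.
- refine (tame_mono (H 0%N (fun=> 0) (Var v) opfun0) _) => x x' e _ _.
  by apply; rewrite /linform mul1r add0r.
- have or : opfun (fun n => (r n)%:Z).
    by apply: (opfun_ext (N := 0%N) _ (opfun_r 0 0)) => n _; rewrite subn0 addn0.
  refine (tame_mono (H 0%N _ (Cst 0) or) _) => x x' e /inR_idx Ex /inR_idx Ex'.
  by apply; rewrite /linform mul1r addr0 /=.
- refine (tame_mono (H 0%N (fun=> 0) (Cst c) opfun0) _) => x x' e _ _.
  by apply; rewrite /linform mul1r add0r.
- apply: IH1 => D1 g1 s1 o1; apply: IH2 => D2 g2 s2 o2.
  have og := opfunD (opfunZ D2.+1%:Z o1) (opfunZ D1.+1%:Z o2).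
  pose s := Add (Mul D2.+1%:Z s1) (Mul D1.+1%:Z s2).
  refine (tame_mono (H (D1.+1 * D2.+1).-1 _ s og) _).
  move=> x x' e _ _ HT E2 E2' E1 E1'; apply: HT.
  - rewrite /linform prednK // PoszM /=; move: E1 E2; rewrite /linform.
    move: D1.+1%:Z D2.+1%:Z => a b F1 F2.
    transitivity (b * (a * tev (ext x e) t1) + a * (b * tev (ext x e) t2)); first by ring.
    by rewrite F1 F2; ring.
  - rewrite /linform prednK // PoszM /=; move: E1' E2'; rewrite /linform.
    move: D1.+1%:Z D2.+1%:Z => a b F1 F2.
    transitivity (b * (a * tev (ext x' e) t1) + a * (b * tev (ext x' e) t2)); first by ring.
    by rewrite F1 F2; ring.
- apply: IH => D g s og.
  refine (tame_mono (H D _ (Mul c s) (opfunZ c og)) _) => x x' e _ _ HT Ex Ex'.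
  by apply: HT; rewrite /linform /= mulrCA -mulrDr; congr (_ * _).
(* The quotient is floor((g + s) / m). If [g] has residue k modulo [m], it equals (g - k) / m +
   floor((s + k) / m), a linear form with denominator [m]. The colours fix k. *)
- apply: IH => D g s og; pose m := (D.+1 * d.+1)%N.
  have Em : m = m.-1.+1 by [].

  have m0 : m%:Z != 0 by [].

  have Hcong := rtame_cong V m.-1 og; rewrite -Em in Hcong.
  apply: (tame_cases (m := m) (P := fun k x x' e =>
     (g (idx x) %% m%:Z)%Z = k%:Z /\ (g (idx x') %% m%:Z)%Z = k%:Z)).
    refine (tame_mono Hcong _) => x x' e _ _; rewrite -eqz_mod_dvd => /eqP E.
    have ge0 := modz_ge0 (g (idx x)) m0; have lt_m := ltz_mod (g (idx x)) m0.
    exists (absz (g (idx x) %% m%:Z)%Z); first by lia.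
    by rewrite -E gez0_abs.
  move=> k _; pose s' := Add (Cst (- k%:Z)) (Mul m%:Z (Div m.-1 (Add s (Cst k%:Z)))).
  refine (tame_mono (H m.-1 g s' og) _) => x x' e _ _ HT [Ek Ek'] Ex Ex'.
  have div_form y : linform D g s t y e -> (g (idx y) %% m%:Z)%Z = k%:Z ->
      linform m.-1 g s' (Div d t) y e.
    rewrite /linform /= -Em (divz_mul_nat _ d D) => -> Ey.
    rewrite {1}(divz_eq (g (idx y)) m%:Z) Ey -addrA divzMDl //.
    rewrite mulrDr [k%:Z + _]addrC {2}(divz_eq (g (idx y)) m%:Z) Ey; ring.
  by apply: HT; apply: div_form.
- apply: IH => D g s og; exact: rtame_linform_TR og H.
Qed.

(** No restriction on the rank: once the term is a linear form, its sign is a comparison of an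
    operator with a term in the parameters. *)
Lemma rtame_qf V (f : qf (option V)) :
  rtame (fun x x' e => qev (ext x e) f = qev (ext x' e) f).
Proof.
elim: f => [t|g IH|g IHg h IHh] /=.
- apply: (rtame_linform (t := t)) => D g s og.
  refine (tame_mono (rtame_cmp s og) _) => x x' e _ _ E Ex Ex'.
  have D0 : 0 < D.+1%:Z by [].
  by rewrite -(pmulr_rgt0 _ D0) Ex E -Ex' pmulr_rgt0.
- by refine (tame_mono IH _) => x x' e _ _ ->.
by refine (tame_mono2 IHg IHh _) => x x' e _ _ -> ->.
Qed.

(** * Quantifier elimination *)

Lemma tev_wk V (x z : int) (e : V -> int) t :
  tev (ext x (ext z e)) (tren (omap some) t) = tev (ext x e) t.
Proof. by rewrite tev_sub; apply: eq_tev; case. Qed.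

Lemma qev_wk V (x z : int) (e : V -> int) f :
  qev (ext x (ext z e)) (qren (omap some) f) = qev (ext x e) f.
Proof. by rewrite qev_sub; apply: eq_qev; case. Qed.

Lemma trn_wk V (t : tm (option V)) :
  trn (@isx (option V)) (tren (omap some) t) = trn (@isx V) t.
Proof. by apply: trn_sub => -[]. Qed.

Lemma qtrn_wk V (f : qf (option V)) :
  qtrn (@isx (option V)) (qren (omap some) f) = qtrn (@isx V) f.
Proof. by apply: qtrn_sub => -[]. Qed.

(* An innermost [TR] node above the variable [None] becomes the new variable
   [Some None]. *)
Lemma trn_extract V (t : tm (option V)) : (0 < trn (@isx V) t)%N ->
  exists (t0 : tm (option V)) (t' : tm (option (option V))),
    [/\ trn (@isx V) t0 = 0%N, (trn (@isx (option V)) t' < trn (@isx V) t)%N &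
        forall (x : int) (e : V -> int), tev (ext x e) t =
          tev (ext x (ext (r (idx (tev (ext x e) t0)))%:Z e)) t'].
Proof.
elim: t => //= [t1 IH1 t2 IH2|c t IH|d t IH|u d t IH].
- case: (posnP (trn (@isx V) t1)) => [E1|lt1 _].
    rewrite E1 => /IH2[t0 [t' [H0 lt_t' Ht']]].
    exists t0, (Add (tren (omap some) t1) t'); split=> //=.
      by rewrite trn_wk E1.
    by move=> x e; rewrite tev_wk Ht'.
  have [t0 [t' [H0 lt_t' Ht']]] := IH1 lt1.
  exists t0, (Add t' (tren (omap some) t2)); split=> //=.
    by rewrite trn_wk ltn_add2r.
  by move=> x e; rewrite tev_wk Ht'.
- move=> /IH[t0 [t' [H0 lt_t' Ht']]]; exists t0, (Mul c t'); split=> //= x e.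
  by rewrite Ht'.
- move=> /IH[t0 [t' [H0 lt_t' Ht']]]; exists t0, (Div d t'); split=> //= x e.
  by rewrite Ht'.
case: (posnP (trn (@isx V) t)) => [E|lt _].
  rewrite E addn0 lt0b => hx.
  exists t, (TR u d (Var (Some None))); split=> //=; first by rewrite hx.
  by move=> x e; rewrite idx_r.
have [t0 [t' [H0 lt_t' Ht']]] := IH lt.
exists t0, (TR u d t'); split=> //= [|x e]; last by rewrite Ht'.
have hx : has_in (@isx V) t by apply/negPn/negP => /trn_has; lia.
by rewrite hx; case: (has_in _ t') => /=; lia.
Qed.

Lemma qtrn_extract V (f : qf (option V)) : (0 < qtrn (@isx V) f)%N ->
  exists (t0 : tm (option V)) (f' : qf (option (option V))),
    [/\ trn (@isx V) t0 = 0%N, (qtrn (@isx (option V)) f' < qtrn (@isx V) f)%N &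
        forall (x : int) (e : V -> int), qev (ext x e) f =
          qev (ext x (ext (r (idx (tev (ext x e) t0)))%:Z e)) f'].
Proof.
elim: f => //= [t|g IH|g IHg h IHh].
- move=> /trn_extract[t0 [t' [H0 lt_t' Ht']]].
  by exists t0, (Pos t'); split=> //= x e; rewrite Ht'.
- move=> /IH[t0 [g' [H0 lt_g' Hg']]].
  by exists t0, (Not g'); split=> //= x e; rewrite Hg'.
case: (posnP (qtrn (@isx V) g)) => [Eg|ltg _].
  rewrite Eg => /IHh[t0 [h' [H0 lt_h' Hh']]].
  exists t0, (And (qren (omap some) g) h'); split=> //=.
    by rewrite qtrn_wk Eg.
  by move=> x e; rewrite qev_wk Hh'.
have [t0 [g' [H0 lt_g' Hg']]] := IHg ltg.
exists t0, (And g' (qren (omap some) h)); split=> //=.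
  by rewrite qtrn_wk ltn_add2r.
by move=> x e; rewrite qev_wk Hg'.
Qed.

(* For c in R, says that c is the largest element of R below t, without
   applying [TR] to t. *)
Definition lam_is V (c t : tm V) : qf V :=
  And (Not (And (Pos (Add c (Mul (-1) t)))
                (Pos (Add c (Cst (- (r 0%N)%:Z))))))
      (Pos (Add (TR 1 0 c) (Mul (-1) t))).

Lemma lam_isP V (e : V -> int) (c t : tm V) : inR (tev e c) ->
  qev e (lam_is c t) = (tev e c == (r (idx (tev e t)))%:Z).
Proof.
case=> k Ek; rewrite /= Ek idx_r subn0 addn1 eqz_nat.
have rk : (r 0%N <= r k)%N by rewrite leq_r.
apply/idP/eqP => [H|Et].
  congr r; symmetry; apply: eq_idx; first by lia.
  by case: k H rk {Ek} => [|k] H _; [right | left; have := @ltn_r 0 k.+1; lia].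
have /eqP Ek' : k == idx (tev e t).
  by rewrite eqn_leq -(leq_r k) -(leq_r (idx _)) Et leqnn.
have := idx_lt (tev e t); rewrite -Ek'.
case: k Ek' {Et Ek rk} => [|k] Ek'; first by lia.
by have := @idx_pos (tev e t); rewrite -Ek'; lia.
Qed.

Lemma trn_lam_is V (p : V -> bool) (c t : tm V) :
  ~~ has_in p c -> trn p t = 0%N -> qtrn p (lam_is c t) = 0%N.
Proof. by move=> hc /= ->; rewrite (trn_has hc) (negbTE hc). Qed.

Lemma def_ex_qf V (f : qf (option V)) : def (fun e => exists x, qev (ext x e) f).
Proof.
have [n] := ubnP (qtrn (@isx V) f); elim: n V f => // n IH V f.
rewrite ltnS => le_n; case: (posnP (qtrn (@isx V) f)) => [|lt_f].
  by move/ztame_qf/def_ex_ztame.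
have [t0 [f' [H0 lt_f' Hf']]] := qtrn_extract lt_f.
(* The new variable stands for lam(t0). As [l] does not apply [TR] to [t0], it has rank zero and the
   conjunction has the rank of [f']. *)
pose l := lam_is (Var (Some None)) (tren (omap some) t0); pose g := And l f'.
have [|h Hh] := IH _ g.
  have -> : qtrn (@isx _) g = (qtrn (@isx _) l + qtrn (@isx _) f')%N by [].
  by rewrite trn_lam_is ?trn_wk //; lia.
apply: def_iff (def_ex_rtame (rtame_qf h)) => e.
have Eg x k : qev (ext x (ext (r k)%:Z e)) g =
    (r k == r (idx (tev (ext x e) t0))) && qev (ext x (ext (r k)%:Z e)) f'.
  have -> : qev (ext x (ext (r k)%:Z e)) g = qev (ext x (ext (r k)%:Z e)) l &&
    qev (ext x (ext (r k)%:Z e)) f' by [].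
  rewrite lam_isP; last by exists k.
  by rewrite tev_wk /= eqz_nat.
split=> [[k /Hh[x]]|[x Hx]].
  by rewrite Eg => /andP[/eqP Ek Hx]; exists x; rewrite Hf' -Ek.
exists (idx (tev (ext x e) t0)); apply/Hh; exists x.
by rewrite Eg eqxx -Hf'.
Qed.

Lemma def_ex V (P : (option V -> int) -> Prop) :
  def P -> def (fun e => exists x, P (ext x e)).
Proof.
move=> [f Hf]; apply: def_iff (def_ex_qf f) => e.
by split=> -[x Hx]; exists x; apply/Hf.
Qed.

Lemma def_all V (P : (option V -> int) -> Prop) :
  def P -> def (fun e => forall x, P (ext x e)).
Proof.
move=> dP; apply: def_iff (def_not (def_ex (def_not dP))) => e; split.
  by move=> H x; case: (defP (ext x e) dP) => // nP; case: H; exists x.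
by move=> H [x]; apply; exact: H.
Qed.

(** * Strong honest definitions *)

(** The condition |B| >= 2 for a family indexed by a finite type, in which repetitions are
    allowed. *)
Definition distinct (I Y : Type) (b : I -> Y -> int) : Prop :=
  exists i j y, b i y <> b j y.

Definition determines (X : Type) (Y : Type) (D : (X -> int) -> Prop)
    (T : (X -> int) -> (X -> int) -> (Y -> int) -> Prop)
    (K : finType) (psi : (X -> int) -> (K -> Y -> int) -> Prop)
    (a : X -> int) (I : finType) (b : I -> Y -> int) : Prop :=
  exists c : K -> I, psi a (fun k => b (c k)) /\
    forall a', D a' -> psi a' (fun k => b (c k)) -> forall i, T a a' (b i).

Definition def_fam (X Y : Type) (K : finType)
    (psi : (X -> int) -> (K -> Y -> int) -> Prop) : Prop :=
  def (fun e : X + K * Y -> int =>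
    psi (fun x => e (inl x)) (fun k y => e (inr (k, y)))).

(* Existence of a strong honest definition psi for tuples a in D and finite
   families b of parameters, where the relation T a a' y stands for the agreement
   of a and a' on the formula at y; with a relation instead of a formula, strong
   honest definitions can be combined by [shd_and] and [shd_mono]. *)
Definition shd (X Y : Type) (D : (X -> int) -> Prop)
    (T : (X -> int) -> (X -> int) -> (Y -> int) -> Prop) : Prop :=
  exists (K : finType) (psi : (X -> int) -> (K -> Y -> int) -> Prop),
    def_fam psi /\ forall a, D a -> forall (I : finType) (b : I -> Y -> int),
      distinct b -> determines D T psi a b.

Section Shd.
Variables (X : Type) (Y : finType) (D : (X -> int) -> Prop).
Implicit Types T : (X -> int) -> (X -> int) -> (Y -> int) -> Prop.

Lemma shd_mono T1 T2 : shd D T1 ->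
  (forall a a' y, D a -> D a' -> T1 a a' y -> T2 a a' y) -> shd D T2.
Proof.
move=> [K [psi [dpsi H]]] T12; exists K, psi; split=> // a Da I b db.
have [c [Hc HT]] := H a Da I b db; exists c; split=> // a' Da' Ha' i.
by apply: T12 => //; exact: HT.
Qed.

Lemma shd_const T : (forall a a' y, D a -> D a' -> T a a' y) -> shd D T.
Proof.
move=> HT; exists void, (fun _ _ => True); split; first exact: def_true.
move=> a Da I b _; exists (fun v : void => match v with end).
by split=> // a' Da' _ i; exact: HT.
Qed.

Lemma shd_and T1 T2 : shd D T1 -> shd D T2 ->
  shd D (fun a a' y => T1 a a' y /\ T2 a a' y).
Proof.
move=> [K1 [psi1 [d1 H1]]] [K2 [psi2 [d2 H2]]].
exists (K1 + K2)%type, (fun a d =>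
  psi1 a (fun k => d (inl k)) /\ psi2 a (fun k => d (inr k))); split.
  apply: def_and.
    exact: (def_ren (fun v : X + K1 * Y => match v with
      | inl x => inl x | inr (k, y) => inr (inl k, y) end) d1).
  exact: (def_ren (fun v : X + K2 * Y => match v with
    | inl x => inl x | inr (k, y) => inr (inr k, y) end) d2).
move=> a Da I b db.
have [c1 [Hc1 HT1]] := H1 a Da I b db; have [c2 [Hc2 HT2]] := H2 a Da I b db.
exists (fun k => match k with inl k1 => c1 k1 | inr k2 => c2 k2 end).
by split=> // a' Da' [Ha1 Ha2] i; split; [exact: HT1 | exact: HT2].
Qed.

Lemma shd_all_in (S : Type) (s : seq S)
    (T : S -> (X -> int) -> (X -> int) -> (Y -> int) -> Prop) :
  (forall u, List.In u s -> shd D (T u)) ->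
  shd D (fun a a' y => forall u, List.In u s -> T u a a' y).
Proof.
elim: s => [|u s IH] H; first exact: shd_const.
have H1 : shd D (T u) by apply: H; left.
have H2 := IH (fun v Hv => H v (or_intror Hv)).
apply: shd_mono (shd_and H1 H2) _ => a a' y _ _ [HT Hs] v [<-|] //.
exact: Hs.
Qed.

(* Two candidate definitions are merged by testing the equality of two
   additional parameters, which needs two distinct elements in the family. *)
Lemma shd_or T (K1 K2 : finType) psi1 psi2 :
  @def_fam X Y K1 psi1 -> @def_fam X Y K2 psi2 ->
  (forall a, D a -> forall (I : finType) (b : I -> Y -> int), distinct b ->
     determines D T psi1 a b \/ determines D T psi2 a b) ->
  shd D T.
Proof.
move=> d1 d2 H; exists (option (option (K1 + K2)%type)), (fun a d =>
  ((forall y, d None y = d (Some None) y) /\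
     psi1 a (fun k => d (Some (Some (inl k))))) \/
  (~ (forall y, d None y = d (Some None) y) /\
     psi2 a (fun k => d (Some (Some (inr k)))))); split.
  have dE : def (fun e : X + option (option (K1 + K2)) * Y -> int =>
      forall y, e (inr (None, y)) = e (inr (Some None, y))).
    apply: def_forall => y.
    exact: (def_eq (Var (inr (None, y))) (Var (inr (Some None, y)))).
  apply: def_or.
    apply: def_and; first exact: dE.
    exact: (def_ren (fun v : X + K1 * Y => match v with
      | inl x => inl x | inr (k, y) => inr (Some (Some (inl k)), y) end) d1).
  apply: def_and; first exact: def_not dE.
  exact: (def_ren (fun v : X + K2 * Y => match v with
    | inl x => inl x | inr (k, y) => inr (Some (Some (inr k)), y) end) d2).
move=> a Da I b db; have [i [j [y0 ne]]] := db.
case: (H a Da I b db) => [[c [Hc HT]]|[c [Hc HT]]].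
  exists (fun k => match k with Some (Some (inl k1)) => c k1 | _ => i end).
  by split=> [|a' Da' [[_ Ha']|[[]]] //]; [left | exact: HT].
exists (fun k => match k with
  | Some (Some (inr k2)) => c k2 | None => i | _ => j end).
split=> [|a' Da' [[/(_ y0)/ne]|[_ Ha']] //]; last exact: HT.
by right; split=> // /(_ y0).
Qed.

(** The sets defined by [p] form a chain within D, so [a] is determined by the smallest one in the
    family that contains it; if there is none, the implication is void. *)
Lemma shd_chain (p : (X -> int) -> (Y -> int) -> Prop) :
  def (fun e : X + Y -> int => p (fun x => e (inl x)) (fun y => e (inr y))) ->
  (forall y y', (forall a, D a -> p a y -> p a y') \/
                (forall a, D a -> p a y' -> p a y)) ->
  shd D (fun a a' y => p a y -> p a' y).
Proof.
move=> dp chain.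
have decp a y : p a y \/ ~ p a y.
  exact: (defP (fun v => match v with inl x => a x | inr z => y z end) dp).
apply: (@shd_or _ unit void (fun a d => p a (d tt)) (fun _ _ => True)).
- exact: (def_ren (fun v : X + Y => match v with
    | inl x => inl x | inr y => inr (tt, y) end) dp).
- exact: def_true.
move=> a Da I b _.
have [none|[i0 [pi0 Hi0]]] : (forall i, ~ p a (b i)) \/ exists i0, p a (b i0) /\
    forall i, p a (b i) -> forall a', D a' -> p a' (b i0) -> p a' (b i).
  suff: (forall i, i \in enum I -> ~ p a (b i)) \/ exists i0, p a (b i0) /\
      forall i, i \in enum I -> p a (b i) ->
        forall a', D a' -> p a' (b i0) -> p a' (b i).
    case=> [H|[i0 [H0 H]]]; [left | right; exists i0; split=> //] => i;
      by apply: H; rewrite mem_enum.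
  elim: (enum I) => [|i s [none|[i0 [H0 H]]]]; first by left.
  - case: (decp a (b i)) => pi; [right; exists i | left]; last first.
      by move=> j; rewrite inE => /orP[/eqP->|/none].
    by split=> // j; rewrite inE => /orP[/eqP->|/none].
  - right; case: (decp a (b i)) => pi; last first.
      by exists i0; split=> // j; rewrite inE => /orP[/eqP->|/H].
    case: (chain (b i0) (b i)) => le.
      exists i0; split=> // j; rewrite inE => /orP[/eqP->|/H Hj] pj a' Da' pa'.
        exact: le.
      exact: Hj.
    exists i; split=> // j; rewrite inE => /orP[/eqP->|/H Hj] pj a' Da' pa' //.
    by apply: Hj => //; exact: le.
- by right; exists (fun v : void => match v with end); split=> // a' Da' _ i /none.
by left; exists (fun=> i0); split=> // a' Da' pa' i pi; exact: Hi0 pa'.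
Qed.

End Shd.

Lemma shd_reindex (X X' : Type) (Y : finType) (h : X' -> X) D
    (T : (X' -> int) -> (X' -> int) -> (Y -> int) -> Prop) :
  shd D T -> shd (fun a : X -> int => D (fun x => a (h x)))
    (fun a a' y => T (fun x => a (h x)) (fun x => a' (h x)) y).
Proof.
move=> [K [psi [dpsi H]]]; exists K, (fun a d => psi (fun x => a (h x)) d); split.
  exact: (def_ren (fun v : X' + K * Y => match v with
    | inl x => inl (h x) | inr k => inr k end) dpsi).
move=> a Da I b /(H _ Da)[c [Hc HT]]; exists c; split=> // a'.
exact: HT.
Qed.

(** The sets x < f(y) form a chain, and so do their complements; the two parameters obtained give
    the nearest terms on both sides of [x]. A colour does not depend on y. *)
Lemma shd_tame D C (Y : finType) T :
  (forall chi : int -> bool, C chi -> def (fun e : unit -> int => chi (e tt))) ->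
  @tame D C Y T ->
  shd (fun a : unit -> int => D (a tt)) (fun a a' y => T (a tt) (a' tt) y).
Proof.
move=> dC; elim=> {T} [f|chi Cchi|T1 T2 _ H1 _ H2|T1 T2 _ H T12].
- have dlt : def (fun e : unit + Y -> int =>
      e (inl tt) < tev (fun y => e (inr y)) f).
    apply: def_iff (def_lt (Var (inl tt)) (tren inr f)) => e.
    by rewrite tev_sub.
  have lt_chain (y y' : Y -> int) :
      (forall a : unit -> int, D (a tt) -> a tt < tev y f -> a tt < tev y' f) \/
      (forall a : unit -> int, D (a tt) -> a tt < tev y' f -> a tt < tev y f).
    by case: (lerP (tev y f) (tev y' f)) => le; [left | right] => a _; lia.
  have ge_chain (y y' : Y -> int) :
      (forall a : unit -> int, D (a tt) -> ~ a tt < tev y f -> ~ a tt < tev y' f) \/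
      (forall a : unit -> int, D (a tt) -> ~ a tt < tev y' f -> ~ a tt < tev y f).
    by case: (lerP (tev y f) (tev y' f)) => le; [right | left] => a _; lia.
  refine (shd_mono (shd_and (shd_chain dlt lt_chain)
    (shd_chain (def_not dlt) ge_chain)) _) => a a' y _ _ [L1 L2].
  by apply/idP/idP => [/L1 //|]; case: (boolP (a tt < _)) => // /negP /L2.
- have dchi := def_ren (fun _ : unit => inl tt : unit + Y) (dC chi Cchi).
  have H1 := @shd_chain unit Y (fun a => D (a tt)) (fun a _ => chi (a tt)) dchi.
  have H2 := @shd_chain unit Y (fun a => D (a tt)) (fun a _ => ~ chi (a tt))
    (def_not dchi).
  refine (shd_mono (shd_and (H1 _) (H2 _)) _) => [y y'|y y'|a a' y _ _ [L1 L2]].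
  + by left.
  + by left.
  by apply/idP/idP => [/L1 //|]; case: (boolP (chi (a tt))) => // /negP /L2.
- exact: shd_and H1 H2.
by refine (shd_mono H _) => a a' y; exact: T12.
Qed.

Lemma def_dvd V (M : nat) (t : tm V) : def (fun e => (M.+1%:Z %| tev e t)%Z).
Proof.
apply: def_iff (def_eq (Mul M.+1%:Z (Div M t)) t) => e /=.
by rewrite mulrC dvdz_eq; split=> [->|/eqP].
Qed.

Lemma def_Zcol chi : Zcol chi -> def (fun e : unit -> int => chi (e tt)).
Proof.
move=> [M [j Hchi]].
apply: def_iff (def_dvd M (Add (Var tt) (Cst (- j)))) => e /=.
by rewrite Hchi.
Qed.

Lemma def_Rcol chi : Rcol chi -> def (fun e : unit -> int => chi (e tt)).
Proof.
move=> [M [u [d [j Hchi]]]].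
apply: def_iff (def_dvd M (Add (TR u d (Var tt)) (Cst (- j)))) => e /=.
by rewrite Hchi.
Qed.

Definition allpts (X : Type) (a : X -> int) : Prop := True.

(* Reduction to fewer variables: if psi1(x; v, c) determines phi(x, v; .) on the
   family, then the formulas [forall x, psi1(x; v, c) -> phi(x, v; y)] and
   [forall x, psi1(x; v, c) -> ~ phi(x, v; y)] only involve v. *)
Lemma shd_fiber (X Y : finType) (D : (X -> int) -> Prop)
    (phi : int -> (X -> int) -> (Y -> int) -> Prop) :
  def (fun e : option X + Y -> int =>
    phi (e (inl None)) (fun x => e (inl (Some x))) (fun y => e (inr y))) ->
  shd (@allpts unit) (fun a a' (w : X + Y -> int) =>
    phi (a tt) (fun x => w (inl x)) (fun y => w (inr y)) <->
    phi (a' tt) (fun x => w (inl x)) (fun y => w (inr y))) ->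
  (forall (Z : finType) (th : (X -> int) -> (Z -> int) -> Prop),
     def (fun e : X + Z -> int => th (fun x => e (inl x)) (fun z => e (inr z))) ->
     shd D (fun a a' z => th a z <-> th a' z)) ->
  shd (fun a : option X -> int => D (fun x => a (Some x)))
    (fun a a' y => phi (a None) (fun x => a (Some x)) y <->
                   phi (a' None) (fun x => a' (Some x)) y).
Proof.
move=> dphi [K1 [psi1 [d1 H1]]] H2.
pose par (v : X -> int) (z : option K1 * Y -> int) (k : K1) (w : X + Y) : int :=
  match w with inl x => v x | inr y => z (Some k, y) end.
pose th (s : bool) (v : X -> int) (z : option K1 * Y -> int) : Prop :=
  forall x : int, psi1 (fun=> x) (par v z) ->
    if s then phi x v (fun y => z (None, y)) else ~ phi x v (fun y => z (None, y)).
have dth s : def (fun e : X + option K1 * Y -> int =>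
    th s (fun x => e (inl x)) (fun z => e (inr z))).
  have dpsi : def (fun e : option (X + option K1 * Y) -> int =>
      psi1 (fun=> e None) (par (fun x => e (Some (inl x))) (fun z => e (Some (inr z))))).
    have := def_ren (fun v : unit + K1 * (X + Y) => match v with
      | inl _ => None
      | inr (k, inl x) => Some (inl x)
      | inr (k, inr y) => Some (inr (Some k, y)) end :
        option (X + option K1 * Y)) d1.
    apply: def_iff => e.
    have -> : par (fun x => e (Some (inl x))) (fun z => e (Some (inr z))) =
        fun k w => e match w with
          | inl x => Some (inl x) | inr y => Some (inr (Some k, y)) end.
      by apply: functional_extensionality => k; apply: functional_extensionality => -[].
    exact: iff_refl.
  have dph := def_ren (fun v : option X + Y => match v with
    | inl None => None | inl (Some x) => Some (inl x)
    | inr y => Some (inr (None, y)) end : option (X + option K1 * Y)) dphi.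
  by case: s; [exact: (def_all (def_imp dpsi dph))
           | exact: (def_all (def_imp dpsi (def_not dph)))].
have [K2 [psi2 [d2 {}H2]]] := shd_and (H2 _ _ (dth true)) (H2 _ _ (dth false)).
exists (K1 + K2 * option K1)%type, (fun a d =>
  psi1 (fun=> a None) (par (fun x => a (Some x))
    (fun ky => if ky.1 is Some k then d (inl k) ky.2 else 0)) /\
  psi2 (fun x => a (Some x)) (fun k2 ky => d (inr (k2, ky.1)) ky.2)); split.
  apply: def_and.
    have := def_ren (fun v : unit + K1 * (X + Y) => match v with
      | inl _ => inl None
      | inr (k, inl x) => inl (Some x)
      | inr (k, inr y) => inr (inl k, y) end :
        option X + (K1 + K2 * option K1) * Y) d1.
    apply: def_iff => e; set d' := par _ _.
    have -> : d' = fun k w => e match w with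
        | inl x => inl (Some x) | inr y => inr (inl k, y) end.
      by apply: functional_extensionality => k; apply: functional_extensionality => -[].
    exact: iff_refl.
  exact: (def_ren (fun v : X + K2 * (option K1 * Y) => match v with
      | inl x => inl (Some x)
      | inr (k2, ky) => inr (inr (k2, ky.1), ky.2) end :
        option X + (K1 + K2 * option K1) * Y) d2).
move=> a Da I b db; pose v x := a (Some x).
pose b1 i (w : X + Y) := match w with inl x => v x | inr y => b i y end.
have db1 : distinct b1 by have [i [j [y ne]]] := db; exists i, j, (inr y).
have [c1 [Hc1 HT1]] := H1 (fun=> a None) Logic.I I b1 db1.
(* A parameter of [th] consists of the parameters of [psi1], at [Some k], and of y, at [None]; the
   family runs over all such tuples from the given family. *)
pose b2 (f : {ffun option K1 -> I}) (ky : option K1 * Y) := b (f ky.1) ky.2.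
have db2 : distinct b2.
  have [i [j [y ne]]] := db; exists [ffun=> i], [ffun=> j], (None, y).
  by rewrite /b2 /= !ffunE.
have [c2 [Hc2 HT2]] := H2 v Da _ b2 db2.
exists (fun k => match k with inl k1 => c1 k1 | inr (k2, k1) => c2 k2 k1 end).
have parE (u : X -> int) (z : option K1 * Y -> int) :
    (forall k y, z (Some k, y) = b (c1 k) y) ->
    par u z = fun k w => match w with inl x => u x | inr y => b (c1 k) y end.
  move=> Hz; apply: functional_extensionality => k.
  by apply: functional_extensionality => -[x|y] //=.
split.
  split; last exact: Hc2.
  by rewrite parE.
move=> a' Da' [Ha1 Ha2] i; rewrite parE // in Ha1.
have := HT2 _ Da' Ha2.
pose f : {ffun option K1 -> I} := [ffun o => if o is Some k then c1 k else i].
move=> /(_ f) [].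
have pf (u : X -> int) : par u (b2 f) =
    fun k w => match w with inl x => u x | inr y => b (c1 k) y end.
  by apply: parE => k y; rewrite /b2 /= ffunE.
have fN : (fun y => b2 f (None, y)) = b i.
  by apply: functional_extensionality => y; rewrite /b2 /= ffunE.
rewrite /th !pf fN => Ht Hf.
have HT x : psi1 (fun=> x) (fun k w => b1 (c1 k) w) ->
    (phi (a None) v (b i) <-> phi x v (b i)).
  by move=> Hx; exact: (HT1 (fun=> x) Logic.I Hx i).
have eb1 : (fun k w => match w with inl x => v x | inr y => b (c1 k) y end) =
  (fun k w => b1 (c1 k) w) by [].
rewrite eb1 in Ht Hf.
(* Depending on the truth of phi at [a], one of the two formulas [th] holds there. It passes to
   [a'], whose first coordinate satisfies [psi1]. *)
have dec : phi (a None) v (b i) \/ ~ phi (a None) v (b i).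
  exact: (defP (fun u => match u with
    | inl None => a None | inl (Some x) => v x | inr y => b i y end) dphi).
case: dec => [pa|npa]; split=> //.
- by move=> _; apply: Ht.1 Ha1 => x /HT <-.
- by move=> pa'; case: (Hf.1 _ _ Ha1) => // x /HT <-.
Qed.

Lemma shd_inR (Z : finType) (th : (unit -> int) -> (Z -> int) -> Prop) :
  def (fun e : unit + Z -> int => th (fun x => e (inl x)) (fun z => e (inr z))) ->
  shd (fun a : unit -> int => inR (a tt)) (fun a a' z => th a z <-> th a' z).
Proof.
move=> [f Hf].
pose g := qren (fun v : unit + Z => if v is inr z then Some z else None) f.
have thE a z : th a z <-> qev (ext (a tt) z) g.
  have := Hf (fun v => match v with inl x => a x | inr z' => z z' end).
  rewrite qev_sub => -> ; rewrite -(eq_qev (e := fun v => match v with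
    inl x => a x | inr z' => z z' end)) // => -[[]|] //.
refine (shd_mono (shd_tame def_Rcol (rtame_qf g)) _) => a a' z _ _.
by rewrite !thE => ->.
Qed.

(** * Strong honest definitions in one variable over Z *)

(** The difference t(x, y) - t(x, c) up to the sign [s], with [x] replaced by its residue [j]. The
    variables are z, then c, then y. *)
Definition cdiff (Y : Type) (t : tm (option Y)) (s : int) (j : nat) :
    tm (unit + (Y + Y)) :=
  Mul s (Add
    (tsub (fun o => if o is Some y then Var (inr (inr y)) else Cst j%:Z) t)
    (Mul (-1)
      (tsub (fun o => if o is Some y then Var (inr (inl y)) else Cst j%:Z) t))).

(** The possible values of lam(t(x, y)): the default r_0 for negative t, and elements of R within
    [I] steps of z or of lam of the absolute difference. *)
Definition cands (Y : Type) (t : tm (option Y)) (M I : nat) :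
    seq (tm (unit + (Y + Y))) :=
  TR 0 0 (Cst (-1)) :: [seq TR i I (Var (inl tt)) | i <- iota 0 (I + I).+1] ++
  [seq TR i I (cdiff t 1 j) | i <- iota 0 (I + I).+1, j <- iota 0 M] ++
  [seq TR i I (cdiff t (-1) j) | i <- iota 0 (I + I).+1, j <- iota 0 M].

Lemma tev_TR V (e : V -> int) u d t :
  tev e (TR u d t) = (r (idx (tev e t) - d + u))%:Z.
Proof. by []. Qed.

Lemma In_map (S T : Type) (f : S -> T) s x : List.In x s -> List.In (f x) (map f s).
Proof. by elim: s => //= y s IH [->|/IH]; [left | right]. Qed.

Lemma In_catl (T : Type) (s1 s2 : seq T) x : List.In x s1 -> List.In x (s1 ++ s2).
Proof. by move=> H; apply: List.in_or_app; left. Qed.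

Lemma In_catr (T : Type) (s1 s2 : seq T) x : List.In x s2 -> List.In x (s1 ++ s2).
Proof. by move=> H; apply: List.in_or_app; right. Qed.

Lemma In_allpairs (S1 S2 T : Type) (f : S1 -> S2 -> T) s1 s2 x1 x2 :
  List.In x1 s1 -> List.In x2 s2 -> List.In (f x1 x2) [seq f u v | u <- s1, v <- s2].
Proof.
move=> H1 H2; elim: s1 H1 => //= y s IH [->|/IH]; last exact: In_catr.
by apply: In_catl; exact: (In_map (f x1)).
Qed.

Lemma In_iota i n : (i < n)%N -> List.In i (iota 0 n).
Proof. by move=> lt_i; apply/In_mem; rewrite mem_iota. Qed.

Definition penv (Y : Type) (z : int) (c y : Y -> int) (v : unit + (Y + Y)) : int :=
  match v with inl _ => z | inr (inl v) => c v | inr (inr v) => y v end.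

(* Let |u| <= |u + v|, where u and u + v are the values of t at (x, c) and at
   (x, y).  Then u + v is of the order of magnitude of |u| or |v|, and v only
   depends on x through its residue. *)
Lemma cands_cover (Y : Type) (t : tm (option Y)) :
  trn (@isx Y) t = 0%N ->
  exists M I, forall (x z : int) (c y : Y -> int),
    (absz (tev (ext x c) t) <= absz (tev (ext x y) t))%N ->
    z = (r (idx `|tev (ext x c) t|))%:Z ->
    exists2 w, List.In w (cands t M I) &
      tev (penv z c y) w = (r (idx (tev (ext x y) t)))%:Z.
Proof.
move=> /tev_periodicZ[M [al Hal]]; have [I HI] := idx_mul 2.
exists M.+1, I => x z c y le_cy Ez.
set u' := tev (ext x y) t in le_cy *; set u := tev (ext x c) t in le_cy Ez.
have [u'_lt0|u'_ge0] := ltrP u' 0.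
  by exists (TR 0 0 (Cst (-1))); [left | rewrite /= !idx_neg].
pose j := absz (x %% M.+1%:Z)%Z.
have Ej : (x %% M.+1%:Z)%Z = j%:Z by rewrite gez0_abs // modz_ge0.
have lt_j : (j < M.+1)%N by have := ltz_mod x (isT : M.+1%:Z != 0); lia.
have Ex := divz_eq x M.+1%:Z; rewrite Ej in Ex.
(* The multiple of [al] depends only on [x] and cancels in the difference. *)
pose v := u' - u.
have Ev : v = tev (ext j%:Z y) t - tev (ext j%:Z c) t.
  by rewrite /v /u' /u Ex !Hal; ring.
have diffE (s : int) : tev (penv z c y) (cdiff t s j) = s * v.
  rewrite /= !tev_sub Ev mulN1r; congr (_ * (_ - _)); by apply: eq_tev; case.
have near (b : int) : b <= 2 * u' -> u' <= 2 * b ->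
    exists2 i, (i < (I + I).+1)%N & (idx b - I + i)%N = idx u'.
  move=> /HI le1 /HI le2; exists (idx u' - (idx b - I))%N; lia.
(* If |v| <= |u|, then |u| <= u' <= 2 |u|; otherwise |v| <= 2 u' and u' <= 2 |v|. *)
have [le_vu|lt_uv] := lerP `|v| `|u|.
  have [||i lt_i Ei] := near `|u|; [by lia | by lia |].
  exists (TR i I (Var (inl tt))); last by rewrite /= Ez idx_r Ei.
  by right; apply: In_catl; apply: (In_map (fun i => TR i I _)); exact: In_iota.
have [||i lt_i Ei] := near `|v|; [by lia | by lia |].
case: (lerP 0 v) => v0.
  exists (TR i I (cdiff t 1 j)).
    by right; apply: In_catr; apply: In_catl; apply: In_allpairs; exact: In_iota.
  rewrite tev_TR diffE mul1r.
  by rewrite -Ei ger0_norm.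
exists (TR i I (cdiff t (-1) j)).
  by right; apply: In_catr; apply: In_catr; apply: In_allpairs; exact: In_iota.
rewrite tev_TR diffE mulN1r.
by rewrite -Ei ltr0_norm.
Qed.

Lemma cands_inR (Y : Type) (t : tm (option Y)) M I w e :
  List.In w (cands t M I) -> inR (tev e w).
Proof.
pose isTR (w : tm (unit + (Y + Y))) := if w is TR _ _ _ then true else false.
have all_TR : all isTR (cands t M I).
  have pairs (g : nat -> tm (unit + (Y + Y))) s1 s2 :
      all isTR [seq TR i I (g j) | i <- s1, j <- s2].
    by elim: s1 => //= i s1 IH; rewrite all_cat IH all_map all_predT.
  rewrite /cands -cat1s; do 3 rewrite all_cat.
  rewrite (pairs (cdiff t 1)) (pairs (cdiff t (-1))) !andbT.
  by rewrite all_map all_predT.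
elim: (cands t M I) all_TR => //= w' s IH /andP[TRw' /IH {}IH] [<-|] //.
by case: w' TRw' => // u d s' _; exists (idx (tev e s') - d + u)%N.
Qed.

Lemma argmin_fam (I : finType) (F : I -> nat) (i0 : I) :
  exists i, forall j, (F i <= F j)%N.
Proof. by case: (arg_minnP F (isT : xpredT i0)) => i _ H; exists i => j; exact: H. Qed.

(** Induction on the rank. For a candidate [w], the formula [ec w] says that [w] is lam(t(x, y)),
    and [fc w] is [f'] with [w] substituted for it. Both have smaller rank, and together they
    determine [f]. *)
Lemma shd_qf (Y : finType) (f : qf (option Y)) :
  shd (@allpts unit)
    (fun a a' y => qev (ext (a tt) y) f = qev (ext (a' tt) y) f).
Proof.
have [n] := ubnP (qtrn (@isx Y) f); elim: n Y f => // n IH Y f.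
rewrite ltnS => le_n; case: (posnP (qtrn (@isx Y) f)) => [|lt_f].
  by move/ztame_qf => tf; exact: (shd_tame def_Zcol tf).
have [t [f' [Ht lt_f' Hf']]] := qtrn_extract lt_f.
have [M [I cover]] := cands_cover Ht; pose cs := cands t M I.
pose fib (g : qf (option (unit + (Y + Y)))) (a : option unit -> int) (w : Y + Y -> int) :=
  qev (ext (a None) (fun v => match v with inl x => a (Some x) | inr y => w y end)) g.
(* The induction hypothesis treats [x] with z as a parameter, and tameness over R treats z. *)
have Hfib g : (qtrn (@isx _) g < n)%N ->
    shd (fun a : option unit -> int => inR (a (Some tt)))
      (fun a a' w => fib g a w <-> fib g a' w).
  move=> lt_g; pose phi (x : int) (v : unit -> int) (w : Y + Y -> int) : Prop :=
    qev (ext x (fun u => match u with inl z => v z | inr y => w y end)) g.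
  apply: (shd_fiber (X := unit) (D := fun a => inR (a tt)) (phi := phi)).
  - have := def_qf (qren (fun o => match o with
      | None => inl None | Some (inl z) => inl (Some z) | Some (inr y) => inr y end :
        option unit + (Y + Y)) g).
    apply: def_iff => e; rewrite qev_sub /phi.
    by rewrite (eq_qev (e' := ext (e (inl None)) (fun u => match u with
      inl z => e (inl (Some z)) | inr y => e (inr y) end))) // => -[[]|].
  - refine (shd_mono (IH _ g lt_g) _) => a a' w _ _ E.
    have wE : w = fun u => match u with inl z => w (inl z) | inr y => w (inr y) end.
      by apply: functional_extensionality => -[].
    by rewrite /phi -wE E.
  - by move=> Z th; exact: shd_inR.
pose s' (w : tm (unit + (Y + Y))) (o : option (option Y)) :
    tm (option (unit + (Y + Y))) :=
  match o with
  | None => Var None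
  | Some None => tren some w
  | Some (Some y) => Var (Some (inr (inr y)))
  end.
pose fc w := qsub (s' w) f'.
pose ec (w : tm (unit + (Y + Y))) := lam_is (tren some w)
  (tren (fun o => if o is Some y then Some (inr (inr y)) else None) t).
have has_some (w : tm (unit + (Y + Y))) : has_in (@isx _) (tren some w) = false.
  by rewrite (has_sub (p := xpred0)) //; elim: w => //= w1 -> w2 ->.
have lt_fc w : (qtrn (@isx _) (fc w) < n)%N.
  rewrite (qtrn_sub (p := @isx _)); first exact: leq_trans lt_f' le_n.
    by case=> [[y|]|] //=.
  by case=> [[y|]|] //=; rewrite trn_has // has_some.
have lt_ec w : (qtrn (@isx _) (ec w) < n)%N.
  rewrite trn_lam_is ?has_some //; first by lia.
  by rewrite (trn_sub (p := @isx _)) // => -[].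
have [K [psi [dpsi Hpsi]]] := shd_all_in (s := cs)
  (fun w _ => shd_and (Hfib _ (lt_ec w)) (Hfib _ (lt_fc w))).
pose env (a : unit -> int) (d : option K -> Y -> int) (v : unit + option K * Y) :=
  match v with inl x => a x | inr (k, y) => d k y end.
pose t1 : tm (option (unit + option K * Y)) :=
  tren (fun o => if o is Some y then Some (inr (None, y)) else Some (inl tt)) t.
have t1E z a d : tev (ext z (env a d)) t1 = tev (ext (a tt) (d None)) t.
  by rewrite tev_sub; apply: eq_tev; case.
(* z is not a parameter: it is recovered from [x] and the parameter at [None] as lam |t|, by cases
   on the sign of t, and its quantifier is eliminated. *)
pose P (e : option (unit + option K * Y) -> int) : Prop :=
  ((tev e (Cst 0) <= tev e t1 -> tev e (Var None) = tev e (TR 0 0 t1)) /\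
   (tev e t1 < tev e (Cst 0) ->
      tev e (Var None) = tev e (TR 0 0 (Mul (-1) t1)))) /\
  psi (fun o => e (match o with Some _ => None | None => Some (inl tt) end))
    (fun k w => e (match w with
       | inl y => Some (inr (None, y)) | inr y => Some (inr (Some k, y)) end)).
have dP : def P.
  apply: def_and; last first.
    exact: (def_ren (fun v : option unit + K * (Y + Y) => match v with
      | inl o => match o with Some _ => None | None => Some (inl tt) end
      | inr (k, w) => match w with
         | inl y => Some (inr (None, y)) | inr y => Some (inr (Some k, y)) end
      end : option (unit + option K * Y)) dpsi).
  by apply: def_and; apply: def_imp (def_eq _ _); [exact: def_le | exact: def_lt].
have PE z a d : P (ext z (env a d)) <->
    z = (r (idx `|tev (ext (a tt) (d None)) t|))%:Z /\
    psi (ext (a tt) (fun=> z)) (fun k w =>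
      match w with inl y => d None y | inr y => d (Some k) y end).
  rewrite /P; set psiz := psi _ _; set psiz' := psi _ _.
  have -> : psiz = psiz'.
    congr psi; first by apply: functional_extensionality => -[].
    by apply: functional_extensionality => k; apply: functional_extensionality => -[].
  rewrite /= !t1E mulN1r !subn0 !addn0.
  have [h|h] := lerP 0 (tev (ext (a tt) (d None)) t).
    rewrite ger0_norm //; split=> [[[Ez _] Hz]|[-> Hz]] //; by rewrite Ez.
  rewrite ltr0_norm //; split=> [[[_ Ez] Hz]|[-> Hz]] //; by rewrite Ez.
exists (option K), (fun a d => exists z, P (ext z (env a d))); split.
  apply: def_iff (def_ex dP) => e.
  have -> : e = env (fun x => e (inl x)) (fun k y => e (inr (k, y))).
    by apply: functional_extensionality => -[|[]].
  exact: iff_refl.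
move=> a _ J b db; have [j0 [j1 [y0 ne]]] := db.
have [i0 min_i0] := argmin_fam (fun i => absz (tev (ext (a tt) (b i)) t)) j0.
pose b' i (w : Y + Y) := match w with inl y => b i0 y | inr y => b i y end.
have db' : distinct b' by exists j0, j1, (inr y0).
pose z := (r (idx `|tev (ext (a tt) (b i0)) t|))%:Z.
have Rz : inR z by eexists.
have [c [Hc HT]] := Hpsi (ext (a tt) (fun=> z)) Rz J b' db'.
exists (fun o => if o is Some k then c k else i0); split.
  by exists z; apply/PE; split.
move=> a' _ [z' /PE[Ez' Hz']] i.
have Rz' : inR z' by rewrite Ez'; eexists.
have {HT} := HT (ext (a' tt) (fun=> z')) Rz' Hz' i.
have fibE g x u : fib g (ext x (fun=> u)) (b' i) =
    qev (ext x (penv u (b i0) (b i))) g.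
  by apply: eq_qev => -[[|[]]|].
have ecE w x u : List.In w cs -> qev (ext x (penv u (b i0) (b i))) (ec w) =
    (tev (penv u (b i0) (b i)) w == (r (idx (tev (ext x (b i)) t)))%:Z).
  move=> /cands_inR Hw; have E1 : tev (ext x (penv u (b i0) (b i))) (tren some w) =
      tev (penv u (b i0) (b i)) w by rewrite tev_sub.
  rewrite lam_isP E1 // tev_sub; congr (_ == Posz (r (idx _))).
  by apply: eq_tev; case.
have fcE w x u : qev (ext x (penv u (b i0) (b i))) (fc w) =
    qev (ext x (ext (tev (penv u (b i0) (b i)) w) (b i))) f'.
  rewrite qev_sub; apply: eq_qev => -[[y|]|] //=.
  by rewrite tev_sub.
(* Some candidate [w] is correct at [a]. Agreement on [ec w] makes it correct at [a'], and agreement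
   on [fc w] then gives agreement on [f]. *)
have [w w_cs Ew] := cover (a tt) z (b i0) (b i) (min_i0 i) erefl.
move=> /(_ w w_cs) []; rewrite !fibE !ecE // !fcE Ew eqxx => -[/(_ isT)/eqP Ew' _].
by rewrite Ew' !Hf' => -[H1 H2]; apply/idP/idP.
Qed.

Lemma shd_def n (Y : finType) (th : ('I_n -> int) -> (Y -> int) -> Prop) :
  def (fun e : 'I_n + Y -> int => th (fun x => e (inl x)) (fun y => e (inr y))) ->
  shd (@allpts 'I_n) (fun a a' y => th a y <-> th a' y).
Proof.
elim: n Y th => [|n IH] Y th dth.
  apply: shd_const => a a' y _ _; have -> // : a = a'.
  by apply: functional_extensionality => -[].
pose phi (x : int) (v : 'I_n -> int) y := th (fun i => ext x v (unlift ord0 i)) y.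
have thE a y : phi (a ord0) (fun j => a (lift ord0 j)) y <-> th a y.
  rewrite /phi; have -> // : (fun i => ext (a ord0) (fun j => a (lift ord0 j))
    (unlift ord0 i)) = a.
  by apply: functional_extensionality => i; case: unliftP => [j|] ->.
have dphi : def (fun e : option 'I_n + Y -> int =>
    phi (e (inl None)) (fun x => e (inl (Some x))) (fun y => e (inr y))).
  apply: def_iff (def_ren (fun v : 'I_n.+1 + Y => match v with
    inl i => inl (unlift ord0 i) | inr y => inr y end) dth) => e.
  rewrite /phi; have -> : (fun i => ext (e (inl None)) (fun x => e (inl (Some x)))
    (unlift ord0 i)) = (fun i => e (inl (unlift ord0 i))).
    by apply: functional_extensionality => i; case: unlift.
  exact: iff_refl.
have Hfib : shd (fun _ : option 'I_n -> int => True) (fun a a' y =>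
    phi (a None) (fun x => a (Some x)) y <-> phi (a' None) (fun x => a' (Some x)) y).
  apply: (shd_fiber (D := @allpts 'I_n) dphi); last exact: IH.
  have [g Hg] := def_ren (fun v : option 'I_n + Y => match v with
    | inl None => None | inl (Some x) => Some (inl x) | inr y => Some (inr y) end :
      option ('I_n + Y)) dphi.
  refine (shd_mono (shd_qf g) _) => a a' w _ _ E.
  by rewrite (Hg (ext (a tt) w)) (Hg (ext (a' tt) w)) E.
have H := shd_reindex
  (fun o : option 'I_n => if o is Some j then lift ord0 j else ord0) Hfib.
by refine (shd_mono H _) => a a' y _ _; rewrite !thE.
Qed.

Variable R : nat -> Prop.
Hypothesis R_enum : forall z, R z <-> exists n, r n = z.

(** * Definability in (Z, <, +, R) *)

(** Definability in the original language. [rho] numbers the variables and [N] bounds these numbers,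
    so [N] is fresh for a quantifier. *)
Definition fdef V (P : (V -> int) -> Prop) : Prop :=
  forall (rho : V -> nat) (N : nat), (forall v, rho v < N)%N ->
    exists phi : formula, forall e, holds R e phi <-> P (fun v => e (rho v)).

Lemma fdef_iff V (P Q : (V -> int) -> Prop) :
  (forall e, P e <-> Q e) -> fdef P -> fdef Q.
Proof.
by move=> PQ dP rho N /dP[phi Hphi]; exists phi => e; rewrite Hphi.
Qed.

Lemma fdef_ren V W (h : V -> W) (P : (V -> int) -> Prop) :
  fdef P -> fdef (fun e => P (fun v => e (h v))).
Proof. by move=> dP rho N Hrho; apply: (dP (fun v => rho (h v)) N). Qed.

Lemma fdef_not V (P : (V -> int) -> Prop) : fdef P -> fdef (fun e => ~ P e).
Proof.
by move=> dP rho N /dP[phi Hphi]; exists (FNot phi) => e /=; rewrite Hphi.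
Qed.

Lemma fdef_and V (P Q : (V -> int) -> Prop) :
  fdef P -> fdef Q -> fdef (fun e => P e /\ Q e).
Proof.
move=> dP dQ rho N Hrho; have [phi Hphi] := dP rho N Hrho.
have [psi Hpsi] := dQ rho N Hrho.
by exists (FAnd phi psi) => e /=; rewrite Hphi Hpsi.
Qed.

Lemma fdef_ex V (P : int -> (V -> int) -> Prop) :
  fdef (fun e : option V -> int => P (e None) (fun v => e (Some v))) ->
  fdef (fun e => exists u, P u e).
Proof.
move=> dP rho N Hrho.
have [|phi Hphi] := dP (fun o => if o is Some v then rho v else N) N.+1.
  by case=> [v|] //=; apply: ltnW; rewrite ltnS.
exists (FEx N phi) => e /=.
have E (u : int) : (fun v => if rho v == N then u else e (rho v)) = (fun v => e (rho v)).
  apply: functional_extensionality => v; case: eqP => // Ev.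
  by have := Hrho v; rewrite Ev ltnn.
by split=> -[u]; [rewrite Hphi eqxx E => H | move=> H]; exists u => //;
  rewrite Hphi eqxx E.
Qed.

Lemma fdef_lt V (x y : V) : fdef (fun e => e x < e y).
Proof. by move=> rho N _; exists (FLt (TVar (rho x)) (TVar (rho y))). Qed.

Lemma fdef_eq V (x y : V) : fdef (fun e => e x = e y).
Proof. by move=> rho N _; exists (FEq (TVar (rho x)) (TVar (rho y))). Qed.

Lemma fdef_add V (x y z : V) : fdef (fun e => e x = e y + e z).
Proof.
by move=> rho N _; exists (FEq (TVar (rho x)) (TAdd (TVar (rho y)) (TVar (rho z)))).
Qed.

Lemma inR_R z : inR z <-> 0 <= z /\ R (absz z).
Proof.
split=> [[n ->]|[z0 /R_enum[n En]]]; first by split=> //; apply/R_enum; exists n.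
by exists n; rewrite En gez0_abs.
Qed.

Lemma fdef_inR V (x : V) : fdef (fun e => inR (e x)).
Proof. by move=> rho N _; exists (FR (TVar (rho x))) => e; rewrite inR_R. Qed.

Definition fgraph V (F : (V -> int) -> int) : Prop :=
  fdef (fun e : option V -> int => e None = F (fun v => e (Some v))).

Lemma fdef_let V (F : (V -> int) -> int) (P : int -> (V -> int) -> Prop) :
  fgraph F -> fdef (fun e : option V -> int => P (e None) (fun v => e (Some v))) ->
  fdef (fun e => P (F e) e).
Proof.
move=> dF dP.
apply: fdef_iff (fdef_ex (P := fun u e => u = F e /\ P u e) (fdef_and dF dP)) => e.
by split=> [[u [->]]|H] //; exists (F e).
Qed.

Lemma fgraph_ren V W (h : V -> W) (F : (V -> int) -> int) :
  fgraph F -> fgraph (fun e => F (fun v => e (h v))).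
Proof. exact: (fdef_ren (omap h)). Qed.

Lemma fgraph_var V (v : V) : fgraph (fun e => e v).
Proof. exact: fdef_eq. Qed.

Lemma fgraph_add V (F G : (V -> int) -> int) :
  fgraph F -> fgraph G -> fgraph (fun e => F e + G e).
Proof.
move=> dF dG; apply: (fdef_let (fgraph_ren some dF)
  (P := fun u e => e None = u + G (fun v => e (Some v)))).
apply: (fdef_let (fgraph_ren some (fgraph_ren some dG))
  (P := fun u e => e (Some None) = e None + u)).
exact: fdef_add.
Qed.

Lemma fgraph_0 V : fgraph (fun _ : V -> int => 0).
Proof.
apply: fdef_iff (fdef_add None None None) => e.
by split=> [|->]; rewrite ?addr0 //; lia.
Qed.

Arguments fgraph_0 V : clear implicits.

Lemma fgraph_opp V (F : (V -> int) -> int) : fgraph F -> fgraph (fun e => - F e).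
Proof.
move=> dF; apply: (fdef_let (fgraph_ren some dF) (P := fun u e => e None = - u)).
have d0 : fdef (fun e : option (option V) -> int => 0 = e (Some None) + e None).
  exact: (fdef_let (fgraph_0 _) (P := fun z e => z = e (Some None) + e None)
    (fdef_add None (Some (Some None)) (Some None))).
by apply: fdef_iff d0 => e; lia.
Qed.

Lemma fgraph_mul V c (F : (V -> int) -> int) : fgraph F -> fgraph (fun e => c * F e).
Proof.
move=> dF; have dn n : fgraph (fun e => n%:Z * F e).
  elim: n => [|n IH]; first by apply: fdef_iff (fgraph_0 V) => e; rewrite mul0r.
  apply: fdef_iff (fgraph_add IH dF) => e.
  by rewrite -addn1 PoszD mulrDl mul1r.
case: c => n; first exact: dn.
by apply: fdef_iff (fgraph_opp (dn n.+1)) => e; rewrite NegzE mulNr.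
Qed.

Lemma fgraph_cst V c : fgraph (fun _ : V -> int => c).
Proof.
suff H1 : fgraph (fun _ : V -> int => 1).
  by apply: fdef_iff (fgraph_mul c H1) => e; rewrite mulr1.
have dmid := fdef_ex (P := fun w (e : option (option V) -> int) =>
  e None < w /\ w < e (Some None)) (fdef_and (fdef_lt (Some None) None)
  (fdef_lt None (Some (Some None)))).
apply: fdef_iff (fdef_let (fgraph_0 _) (P := fun z e => z < e None /\
  ~ exists w, z < w /\ w < e None)
  (fdef_and (fdef_lt None (Some None)) (fdef_not dmid))) => e.
split=> [[lt0 H]|->].
  by case: (ltrP 1 (e None)) => [lt1|]; [case: H; exists 1 | lia].
by split=> // -[w]; lia.
Qed.

Arguments fgraph_cst V c : clear implicits.

Lemma fgraph_div V d (F : (V -> int) -> int) :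
  fgraph F -> fgraph (fun e => (F e %/ d.+1%:Z)%Z).
Proof.
move=> dF.
have dF1 := fgraph_ren some dF.
have dx := fgraph_mul d.+1%:Z (fgraph_var (None : option V)).
have dy := fgraph_add dx (fgraph_cst _ d.+1%:Z).
have lt_graph (G H : (option V -> int) -> int) :
    fgraph G -> fgraph H -> fdef (fun e => G e < H e).
  move=> dG dH; apply: (fdef_let dG (P := fun u e => u < H e)).
  apply: (fdef_let (fgraph_ren some dH) (P := fun u e => e None < u)).
  exact: fdef_lt.
apply: fdef_iff (fdef_and (fdef_not (lt_graph _ _ dF1 dx)) (lt_graph _ _ dF1 dy)) => e.
have := lez_floor (F (fun v => e (Some v))) (isT : d.+1%:Z != 0).
have := ltz_ceil (F (fun v => e (Some v))) (isT : 0 < d.+1%:Z).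
move: (_ %/ _)%Z => w; move: (F _) (e None) => y x.
by split=> [[]|->]; nia.
Qed.

(** All values of [F] satisfy [S], so [Q] has to describe the graph of [G] only there; this allows
    shifts to be described on R. *)
Lemma fgraph_rel V (F : (V -> int) -> int) (S : int -> Prop) (G : int -> int)
    (Q : int -> int -> Prop) :
  (forall u x, S u -> Q u x <-> x = G u) -> (forall e, S (F e)) ->
  fdef (fun e : bool -> int => Q (e true) (e false)) ->
  fgraph F -> fgraph (fun e => G (F e)).
Proof.
move=> QG SF dQ dF.
have d1 : fdef (fun e : option V -> int => Q (F (fun v => e (Some v))) (e None)).
  exact: (fdef_let (fgraph_ren some dF) (P := fun u e => Q u (e None))
    (fdef_ren (fun b : bool => if b then None else Some None) dQ)).
by apply: fdef_iff d1 => e; exact: QG.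
Qed.

Lemma fdef_R_between V (x y : V) :
  fdef (fun e => exists w, inR w /\ e x < w /\ w < e y).
Proof.
exact: (fdef_ex (P := fun w e => inR w /\ e x < w /\ w < e y)
  (fdef_and (fdef_inR None) (fdef_and (fdef_lt (Some x) None) (fdef_lt None (Some y))))).
Qed.

Lemma fdef_R_before V (x : V) : fdef (fun e => exists w, inR w /\ w < e x).
Proof.
exact: (fdef_ex (P := fun w e => inR w /\ w < e x)
  (fdef_and (fdef_inR None) (fdef_lt None (Some x)))).
Qed.

Lemma fgraph_lam V (F : (V -> int) -> int) :
  fgraph F -> fgraph (fun e => (r (idx (F e)))%:Z).
Proof.
(* The last clause is the default: an [x] above [u] must be the least element of R. *)
pose Q u x := inR x /\ ~ (exists w, inR w /\ (x < w /\ ~ u < w)) /\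
  ~ (u < x /\ exists w, inR w /\ w < x).
apply: (@fgraph_rel V F (fun=> True) (fun u => (r (idx u))%:Z) Q) => //.
  move=> u x _; split=> [[[k ->] [Hup Hdn]]|->].
    congr (Posz (r _)); symmetry; apply: eq_idx.
      rewrite ltNge; apply/negP => le_u; apply: Hup; exists (r k.+1)%:Z.
      by split; [exists k.+1 | have := r_incr k; split; lia].
    case: k Hdn {Hup} => [|k] Hdn; [by right | left].
    rewrite leNgt; apply/negP => lt_u; apply: Hdn; split=> //.
    by exists (r k)%:Z; split; [exists k | have := r_incr k; lia].
  split; first by exists (idx u).
  split=> [[w [[k ->] [lt_k le_k]]]|[lt_u [w [[k ->] lt_k]]]].
    by have := @idx_ge u k; have := leq_r k (idx u); lia.
  have pos_u : (0 < idx u)%N by case: (idx u) lt_k => // lt_k; have := leq_r 0 k; lia.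
  by have := idx_pos pos_u; lia.
have dup := fdef_ex (P := fun w (e : bool -> int) =>
    inR w /\ (e false < w /\ ~ e true < w))
  (fdef_and (fdef_inR None) (fdef_and (fdef_lt (Some false) None)
    (fdef_not (fdef_lt (Some true) None)))).
exact: (fdef_and (fdef_inR false) (fdef_and (fdef_not dup)
  (fdef_not (fdef_and (fdef_lt true false) (fdef_R_before false))))).
Qed.

Lemma fgraph_TR V u d (F : (V -> int) -> int) :
  fgraph F -> fgraph (fun e => (r (idx (F e) - d + u))%:Z).
Proof.
move=> dF; elim: u => [|u IH]; last first.
  pose Q y x := inR x /\ (y < x /\ ~ exists w, inR w /\ (y < w /\ w < x)).
  apply: fdef_iff (@fgraph_rel V _ inR (fun y => (r (idx y).+1)%:Z) Q _ _ _ IH).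
  - by move=> e; rewrite idx_r addnS.
  - move=> y x [n ->]; rewrite idx_r; split=> [[[k ->] [lt_k Hk]]|->].
      have [lt_nk|] : (n < k)%N \/ (k <= n)%N by lia.
        case: (ltngtP n.+1 k) lt_nk => // [lt _|-> //]; case: Hk.
        exists (r n.+1)%:Z; split; first by exists n.+1.
        by have := r_incr n; have := ltn_r lt; lia.
      by rewrite -leq_r; lia.
    split; first by exists n.+1.
    split; first by have := r_incr n; lia.
    case=> w [[k ->] [lt1 lt2]].
    have := leq_r k n; have := leq_r n.+1 k; lia.
  - by move=> e; eexists.
  exact: (fdef_and (fdef_inR false) (fdef_and (fdef_lt true false)
    (fdef_not (fdef_R_between true false)))).
elim: d => [|d IH].
  by apply: fdef_iff (fgraph_lam dF) => e; rewrite subn0 addn0.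
(* The last clause permits x = y only for the least element of R, which is its own predecessor. *)
pose Q y x := inR x /\ (~ y < x /\ (~ (exists w, inR w /\ (x < w /\ w < y)) /\
  ~ (x = y /\ exists w, inR w /\ w < y))).
apply: fdef_iff (@fgraph_rel V _ inR (fun y => (r (idx y).-1)%:Z) Q _ _ _ IH).
- by move=> e; rewrite idx_r !addn0 subnS.
- move=> y x [n ->]; rewrite idx_r; split=> [[[k ->] [ge_k [Hbet Hmin]]]|->].
    have le_kn : (k <= n)%N by rewrite -leq_r; lia.
    case: n le_kn ge_k Hbet Hmin => [|n] le_kn ge_k Hbet Hmin.
      by move: le_kn; rewrite leqn0 => /eqP ->.
    have lt_n := r_incr n.
    case: (ltngtP k n) => [lt_kn|gt_kn|-> //].
      by case: Hbet; exists (r n)%:Z; split; [exists n | have := ltn_r lt_kn; lia].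
    have Ek : k = n.+1 by lia.
    by case: Hmin; rewrite Ek; split=> //; exists (r n)%:Z; split; [exists n | lia].
  split; first by exists n.-1.
  split; first by have := leq_r n.-1 n; lia.
  split=> [[w [[k ->] [lt1 lt2]]]|[E [w [[k ->] lt_k]]]].
    by have := leq_r k n.-1; have := leq_r n k; lia.
  have := leq_r n k; case: n E lt_k => [|n] E lt_k; first by lia.
  by have := r_incr n; rewrite /= in E; lia.
- by move=> e; eexists.
exact: (fdef_and (fdef_inR false) (fdef_and (fdef_not (fdef_lt true false))
  (fdef_and (fdef_not (fdef_R_between false true))
    (fdef_not (fdef_and (fdef_eq false true) (fdef_R_before true)))))).
Qed.

Lemma fgraph_tm V (t : tm V) : fgraph (fun e => tev e t).
Proof.
elim: t => [v|c|t1 H1 t2 H2|c t H|d t H|u d t H].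
- exact: fgraph_var.
- exact: fgraph_cst.
- exact: fgraph_add.
- exact: fgraph_mul.
- exact: fgraph_div.
- exact: fgraph_TR.
Qed.

Lemma fdef_qf V (f : qf V) : fdef (fun e => qev e f).
Proof.
elim: f => [t|g H|g Hg h Hh] /=.
- apply: (fdef_let (fgraph_cst V 0) (P := fun z e => z < tev e t)).
  apply: (fdef_let (fgraph_ren some (fgraph_tm t)) (P := fun u e => e None < u)).
  exact: fdef_lt.
- by apply: fdef_iff (fdef_not H) => e; split=> /negP.
by apply: fdef_iff (fdef_and Hg Hh) => e; split=> /andP.
Qed.

Lemma def_fdef V (P : (V -> int) -> Prop) : def P -> fdef P.
Proof. by move=> [f Hf]; apply: fdef_iff (fdef_qf f) => e; rewrite Hf. Qed.

Fixpoint tm_of (t : term) : tm nat :=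
  match t with
  | TVar i => Var i
  | TAdd t1 t2 => Add (tm_of t1) (tm_of t2)
  end.

Lemma tev_tm_of e t : tev e (tm_of t) = teval e t.
Proof. by elim: t => //= t1 -> t2 ->. Qed.

Lemma def_holds (phi : formula) : def (fun e : nat -> int => holds R e phi).
Proof.
elim: phi => [t1 t2|t1 t2|t|g H|g Hg h Hh|i g [f Hf]] /=.
- by apply: def_iff (def_lt (tm_of t1) (tm_of t2)) => e; rewrite !tev_tm_of.
- by apply: def_iff (def_eq (tm_of t1) (tm_of t2)) => e; rewrite !tev_tm_of.
(* An integer lies in R exactly when it is equal to its own lam. *)
- apply: def_iff (def_eq (tm_of t) (TR 0 0 (tm_of t))) => e.
  rewrite -inR_R /= tev_tm_of subn0 addn0; split=> [->|/inR_idx //].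
  by eexists.
- exact: def_not.
- exact: def_and.
apply: def_iff (def_ex_qf (qren (fun j => if j == i then None else Some j) f)) => e.
suff E v : qev (ext v e) (qren (fun j => if j == i then None else Some j) f) <->
    holds R (fun j => if j == i then v else e j) g by split=> -[v /E]; exists v.
rewrite Hf qev_sub (eq_qev (e' := fun j => if j == i then v else e j)) // => j /=.
by case: eqP.
Qed.

End Sparse.

(** * From valuations to tuples of integers *)

Lemma nth_flatten_uniform (T : Type) (x0 : T) (cs : seq (seq T)) m k j :
  (forall i, (i < size cs)%N -> size (nth [::] cs i) = m) ->
  (k < size cs)%N -> (j < m)%N ->
  nth x0 (flatten cs) (k * m + j) = nth x0 (nth [::] cs k) j.
Proof.
elim: cs k => //= c cs IH [|k] Hcs lt_k lt_j.
  by rewrite mul0n add0n nth_cat (Hcs 0%N) // lt_j.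
have Ec := Hcs 0%N isT; rewrite /= in Ec.
rewrite nth_cat Ec mulSn -addnA ltnNge leq_addr /= addKn.
by apply: IH => // i lt_i; exact: (Hcs i.+1).
Qed.

Theorem mainTheorem1 (R : nat -> Prop) (r : nat -> nat) :
  enumerates R r -> sparse_enum r -> cong_periodic_enum r ->
  distal_ZltaddR R.
Proof.
move=> [r_incr R_enum] r_sparse r_periodic n m phi.
have [f Hf] := def_holds r_incr r_sparse r_periodic R_enum phi.
(* Variables beyond the first n + m get the value 0, the default of [nth] in [sat]. *)
pose h (j : nat) : tm ('I_n + 'I_m) :=
  match insub j : option 'I_n with
  | Some i => Var (inl i)
  | None => match insub (j - n)%N : option 'I_m with
            | Some i => Var (inr i)
            | None => Cst _ 0
            end
  end.
pose env (a : 'I_n -> int) (y : 'I_m -> int) (v : 'I_n + 'I_m) :=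
  match v with inl i => a i | inr i => y i end.
pose th a y := is_true (qev r (env a y) (qsub h f)).
have dth : def r (fun e : 'I_n + 'I_m -> int =>
    th (fun i => e (inl i)) (fun i => e (inr i))).
  exists (qsub h f) => e; rewrite /th.
  by rewrite (eq_qev r (e' := e)) // => -[].
have [K [psi [dpsi H]]] := shd_def r_incr r_sparse r_periodic dth.
(* The numbering prescribed for psi: first x, then one block of [m] variables for each element of
   [K]. *)
pose rho (v : 'I_n + K * 'I_m) : nat :=
  match v with inl i => i | inr (k, j) => (n + (nat_of_ord (enum_rank k) * m + j))%N end.
have lt_rho v : (rho v < n + #|K| * m)%N.
  case: v => [i|[k j]] /=; first by rewrite ltn_addr.
  rewrite ltn_add2l; apply: (@leq_trans ((nat_of_ord (enum_rank k)).+1 * m)).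
    by rewrite mulSn addnC ltn_add2r.
  by rewrite leq_mul2r ltn_ord orbT.
have [Psi HPsi] := def_fdef r_incr R_enum dpsi lt_rho.
exists #|K|, Psi => a size_a B uniq_B ge2_B size_B.
pose fa (s : seq int) (i : 'I_n) := nth 0 s i.
pose b (i : 'I_(size B)) (j : 'I_m) := nth 0 (nth [::] B i) j.
have size_b (i : 'I_(size B)) : size (nth [::] B i) = m by apply: size_B; rewrite mem_nth.
have phiE s (i : 'I_(size B)) : size s = n ->
    (sat R phi (s ++ nth [::] B i) <-> th (fa s) (b i)).
  move=> size_s; rewrite /sat Hf /th qev_sub.
  rewrite (eq_qev r (e' := fun v => tev r (env (fa s) (b i)) (h v))) // => j.
  rewrite nth_cat size_s /h; case: insubP => [i' lt_i' <-|/negbTE ->] /=.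
    by rewrite ltn_ord.
  case: insubP => [i' lt_i' /= <- //|/= ge_j].
  by rewrite nth_default // size_b leqNgt.
have db : distinct b.
  have lt0 : (0 < size B)%N by exact: ltnW.
  exists (Ordinal lt0), (Ordinal ge2_B).
  have [/existsP[j /eqP ne]|/existsPn same] :=
    boolP [exists j, b (Ordinal lt0) j != b (Ordinal ge2_B) j]; first by exists j.
  have : nth [::] B 0 == nth [::] B 1.
    apply/eqP/(@eq_from_nth _ 0) => [|j].
      by rewrite (size_b (Ordinal lt0)) (size_b (Ordinal ge2_B)).
    rewrite (size_b (Ordinal lt0)) => lt_j.
    by have /negPn/eqP := same (Ordinal lt_j).
  by rewrite nth_uniq.
have [c [Hc HT]] := H (fa a) Logic.I _ b db.
pose cs := [seq nth [::] B (c k) | k <- enum K].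
have size_cs : size cs = #|K| by rewrite size_map -cardE.
have nth_cs k : nth [::] cs (enum_rank k) = nth [::] B (c k).
  by rewrite (nth_map k) ?nth_enum_rank // -cardE.
have PsiE s : size s = n ->
    (sat R Psi (s ++ flatten cs) <-> psi (fa s) (fun k => b (c k))).
  move=> size_s; rewrite /sat HPsi.
  have -> : (fun x : 'I_n => nth 0 (s ++ flatten cs) (rho (inl x))) = fa s.
    by apply: functional_extensionality => i; rewrite nth_cat size_s ltn_ord.
  have -> // : (fun k (j : 'I_m) => nth 0 (s ++ flatten cs) (rho (inr (k, j)))) =
      fun k => b (c k).
  apply: functional_extensionality => k; apply: functional_extensionality => j.
  rewrite nth_cat size_s ltnNge leq_addr /= addKn.
  rewrite (@nth_flatten_uniform _ _ _ m) ?nth_cs ?size_cs //.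
  move=> i lt_i; have [k' ->] : exists k' : K, i = nat_of_ord (enum_rank k').
    by exists (enum_val (Ordinal lt_i)); rewrite enum_valK.
  by rewrite nth_cs size_b.
exists cs; split=> //.
- by move=> ci /mapP[k _ ->]; rewrite mem_nth.
- exact/PsiE.
move=> a' size_a' /(PsiE _ size_a') Ha' bb /(nthP [::])[i lt_i <-].
rewrite !(phiE _ (Ordinal lt_i)) //.
exact: HT.
Qed.
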